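(* In the setting described in the context, the return map along the homoclinic channel $I$ to the cross section $S_1=\{v_1=h\}$, with coordinates $(v_2,r,\phi)$ and $v_2>0$ small, has the normal form $$\begin{pmatrix}v_2\\ r\\ \phi\end{pmatrix}\mapsto\begin{pmatrix}h\cdot\Big(\dfrac{v_2\,a_1(r,\phi)}{h}\Big)^{\frac{-\varsigma(b_0(r,\phi))}{p(b_0(r,\phi))}}+O(v_2\ln v_2)\\[2mm] b_0(r,\phi)+O(v_2)\\[1mm] c_0(r,\phi)-\dfrac{\omega(b_0(r,\phi))}{p(b_0(r,\phi))}\ln\Big(\dfrac{v_2}{h}\Big)+O(v_2\ln v_2)\pmod 1\end{pmatrix}\qquad (v_2\to0),$$ for some functions $a_1,b_0,c_0$ of $(r,\phi)$ that are $1$-periodic in $\phi$.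
   Context: Setting. A real analytic system $\dot x=F(x)$ in $\mathbb R^4$ has a saddle-center at $0$ with a two-dimensional compact center manifold $D=W^c(0)$ foliated by periodic orbits, and the three-dimensional stable and unstable manifolds of $D$ coincide, forming a non-transverse homoclinic channel $I$. Near $D$ there are analytic coordinates $(v_1,v_2,r,\phi)$, with $(r,\phi)$ polar coordinates on $D=\{v_1=v_2=0\}$, $r\in[0,1]$, $\phi$ taken mod $1$, in which the system reads $$\dot v_1=p(r)v_1+p_0v_1^2v_2,\quad \dot v_2=\varsigma(r)v_2+\varsigma_0v_1v_2^2,\quad \dot r=v_1v_2r_0,\quad \dot\phi=\omega(r)+v_1v_2\omega_0,$$ where $p_0,\varsigma_0,r_0,\omega_0$ are analytic functions of $(v_1,v_2,r,\phi)$, $1$-periodic in $\phi$. Standing assumption: $p(r)>0$, $\varsigma(r)<0$, $p(r)+\varsigma(r)<0$ for all $r$. For a small $h>0$ let $S_1=\{v_1=h\}$ and $S_2=\{v_2=h\}$. The global map from $S_1$ to $S_2$ along $I$ is assumed analytic; the local map from $S_2$ to $S_1$ is given by the flow near $D$; the return map is the composition (local)$\circ$(global)$\,:S_1\to S_1$. *)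

(* Defs.v *)
From Stdlib Require Import Reals ZArith.
From Coquelicot Require Import Coquelicot.

Open Scope R_scope.

(* Points of R^4 are read, according to context, as ambient points, as
   Cartesian chart coordinates (v1, v2, x, y), or as coordinates
   (v1, v2, r, phi).  The angle phi mod 1 is represented by its lift to R. *)
Notation R3 := (R * R * R)%type.
Notation R4 := (R * R * R * R)%type.

(** * Real analyticity *)

Definition analytic_at1 (f : R -> R) (a : R) : Prop :=
  exists (c : nat -> R) (rho : R), 0 < rho /\
    forall x, Rabs (x - a) < rho -> is_pseries c (x - a) (f x).

(* Sum of the monomials of total degree n of the power series with
   coefficients c; the four exponents are i, j, k and n - i - j - k. *)
Definition homogeneous_part (c : nat -> nat -> nat -> nat -> R) (n : nat)
    (u1 u2 u3 u4 : R) : R :=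
  sum_n (fun i => sum_n (fun j => sum_n (fun k =>
    c i j k (n - i - j - k)%nat
      * u1 ^ i * u2 ^ j * u3 ^ k * u4 ^ (n - i - j - k))
    (n - i - j)) (n - i)) n.

(* The bound on the coefficients makes the series absolutely convergent on the
   open polydisc of radius rho (Abel), so that the order of summation is
   irrelevant. *)
Definition analytic_at4 (f : R4 -> R) (a : R4) : Prop :=
  let '(a1, a2, a3, a4) := a in
  exists (c : nat -> nat -> nat -> nat -> R) (rho M : R), 0 < rho /\
    (forall i j k l, Rabs (c i j k l) * rho ^ (i + j + k + l) <= M) /\
    (forall x1 x2 x3 x4 : R,
       Rabs (x1 - a1) < rho -> Rabs (x2 - a2) < rho ->
       Rabs (x3 - a3) < rho -> Rabs (x4 - a4) < rho ->
       is_series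
         (fun n => homogeneous_part c n (x1 - a1) (x2 - a2) (x3 - a3) (x4 - a4))
         (f (x1, x2, x3, x4))).

(* A function of three variables is analytic iff it is analytic as a function
   of four variables that does not depend on the first one. *)
Definition analytic_at3 (f : R3 -> R) (a : R3) : Prop :=
  let '(a1, a2, a3) := a in
  analytic_at4 (fun x => let '(_, x1, x2, x3) := x in f (x1, x2, x3))
    (0, a1, a2, a3).

Definition analytic_map3 (f : R3 -> R3) (a : R3) : Prop :=
  analytic_at3 (fun x => let '(y, _, _) := f x in y) a /\
  analytic_at3 (fun x => let '(_, y, _) := f x in y) a /\
  analytic_at3 (fun x => let '(_, _, y) := f x in y) a.

Definition analytic_map4 (f : R4 -> R4) (a : R4) : Prop :=
  analytic_at4 (fun x => let '(y, _, _, _) := f x in y) a /\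
  analytic_at4 (fun x => let '(_, y, _, _) := f x in y) a /\
  analytic_at4 (fun x => let '(_, _, y, _) := f x in y) a /\
  analytic_at4 (fun x => let '(_, _, _, y) := f x in y) a.

Definition injective_differential {U V : NormedModule R_AbsRing}
    (f : U -> V) (a : U) : Prop :=
  exists L : U -> V, filterdiff f (locally a) L /\
    forall u, L u = zero -> u = zero.

(** * The ambient system x' = F x *)

(* The eigenvalues of A are lam > 0, mu < 0 and the pair +i beta, -i beta;
   u + i w is an eigenvector for i beta. *)
Definition saddle_center (A : R4 -> R4) (lam mu beta : R) : Prop :=
  0 < lam /\ mu < 0 /\ 0 < beta /\
  (exists e : R4, e <> zero /\ A e = scal lam e) /\
  (exists e : R4, e <> zero /\ A e = scal mu e) /\
  (exists u w : R4, (u <> zero \/ w <> zero) /\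
     A u = scal (- beta) w /\ A w = scal beta u).

(* The real plane underlying the eigenspaces of +i beta and -i beta. *)
Definition center_subspace (A : R4 -> R4) (beta : R) (u : R4) : Prop :=
  A (A u) = scal (- beta ^ 2) u.

Definition periodic_orbit_in (F : R4 -> R4) (D : R4 -> Prop) (x : R4) : Prop :=
  exists (g : R -> R4) (T : R), 0 < T /\ g 0 = x /\ F x <> zero /\
    forall t, is_derive g t (F (g t)) /\ g (t + T) = g t /\ D (g t).

Definition stable_set (F : R4 -> R4) (D : R4 -> Prop) (x : R4) : Prop :=
  exists g : R -> R4, g 0 = x /\
    (forall t, 0 <= t -> is_derive g t (F (g t))) /\
    (forall eps : posreal, exists T, forall t, T <= t ->
       exists d, D d /\ ball d eps (g t)).

Definition unstable_set (F : R4 -> R4) (D : R4 -> Prop) (x : R4) : Prop :=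
  exists g : R -> R4, g 0 = x /\
    (forall t, t <= 0 -> is_derive g t (F (g t))) /\
    (forall eps : posreal, exists T, forall t, t <= T ->
       exists d, D d /\ ball d eps (g t)).

(** * Coordinates near the center manifold *)

Record local_system : Type := LocalSystem {
  p : R -> R;
  vsigma : R -> R;
  omega : R -> R;
  p_0 : R4 -> R;
  vsigma_0 : R4 -> R;
  r_0 : R4 -> R;
  omega_0 : R4 -> R
}.

Definition local_field (S : local_system) (x : R4) : R4 :=
  let '(v1, v2, r, phi) := x in
  (p S r * v1 + p_0 S x * v1 ^ 2 * v2,
   vsigma S r * v2 + vsigma_0 S x * v1 * v2 ^ 2,
   v1 * v2 * r_0 S x,
   omega S r + v1 * v2 * omega_0 S x).

(* A neighbourhood of {v1 = v2 = 0, 0 <= r <= 1}: orbits with v1 v2 <> 0 may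
   cross r = 1, and functions analytic on [0,1] extend past the end points.
   Negative r is harmless in polar coordinates. *)
Definition coord_domain (delta : R) (x : R4) : Prop :=
  let '(v1, v2, r, _) := x in
  Rabs v1 < delta /\ Rabs v2 < delta /\ - delta < r < 1 + delta.

Definition cartesian_domain (delta : R) (x : R4) : Prop :=
  let '(v1, v2, x1, x2) := x in
  Rabs v1 < delta /\ Rabs v2 < delta /\ x1 ^ 2 + x2 ^ 2 < (1 + delta) ^ 2.

Definition polar (x : R4) : R4 :=
  let '(v1, v2, r, phi) := x in
  (v1, v2, r * cos (2 * PI * phi), r * sin (2 * PI * phi)).

Definition periodic_on (delta : R) (f : R4 -> R) : Prop :=
  forall v1 v2 r phi, coord_domain delta (v1, v2, r, phi) ->
    f (v1, v2, r, phi + 1) = f (v1, v2, r, phi).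

Record analytic_local_system (S : local_system) (delta : R) : Prop := {
  p_analytic : forall r, - delta < r < 1 + delta -> analytic_at1 (p S) r;
  vsigma_analytic :
    forall r, - delta < r < 1 + delta -> analytic_at1 (vsigma S) r;
  omega_analytic :
    forall r, - delta < r < 1 + delta -> analytic_at1 (omega S) r;
  p_0_analytic : forall x, coord_domain delta x -> analytic_at4 (p_0 S) x;
  vsigma_0_analytic :
    forall x, coord_domain delta x -> analytic_at4 (vsigma_0 S) x;
  r_0_analytic : forall x, coord_domain delta x -> analytic_at4 (r_0 S) x;
  omega_0_analytic :
    forall x, coord_domain delta x -> analytic_at4 (omega_0 S) x;
  p_0_periodic : periodic_on delta (p_0 S);
  vsigma_0_periodic : periodic_on delta (vsigma_0 S);
  r_0_periodic : periodic_on delta (r_0 S);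
  omega_0_periodic : periodic_on delta (omega_0 S)
}.

(* Phi is the parametrization of a neighbourhood of D by Cartesian
   coordinates (v1, v2, x, y); (r, phi) are the polar coordinates of (x, y). *)
Definition chart (Phi : R4 -> R4) (x : R4) : R4 := Phi (polar x).

Definition center_disc (Phi : R4 -> R4) (x : R4) : Prop :=
  exists r phi, 0 <= r <= 1 /\ x = chart Phi (0, 0, r, phi).

Record homoclinic_setting (F Phi : R4 -> R4) (S : local_system) (delta : R)
    : Prop := {
  field_analytic : forall x, analytic_map4 F x;
  field_zero : F zero = zero;

  delta_pos : 0 < delta;
  chart_analytic : forall x, cartesian_domain delta x -> analytic_map4 Phi x;
  chart_immersive :
    forall x, cartesian_domain delta x -> injective_differential Phi x;
  chart_injective :
    forall x y, cartesian_domain delta x -> cartesian_domain delta y ->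
      Phi x = Phi y -> x = y;
  chart_zero : Phi zero = zero;

  (* D is a center manifold of a saddle-center: it is tangent at 0 to the
     center subspace (its invariance follows from [periodic_orbits]). *)
  center_manifold :
    exists (A L : R4 -> R4) (lam mu beta : R),
      filterdiff F (locally (zero : R4)) A /\
      saddle_center A lam mu beta /\
      filterdiff Phi (locally (zero : R4)) L /\
      (forall a b, center_subspace A beta (L (0, 0, a, b)));
  periodic_orbits :
    forall x, center_disc Phi x -> x <> zero ->
      periodic_orbit_in F (center_disc Phi) x;

  (* The homoclinic channel is the common stable and unstable manifold. *)
  manifolds_coincide :
    forall x, stable_set F (center_disc Phi) x
              <-> unstable_set F (center_disc Phi) x;

  system_analytic : analytic_local_system S delta;
  system_in_coordinates :
    forall x, coord_domain delta x ->
      exists L : R4 -> R4, filterdiff (chart Phi) (locally x) L /\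
        L (local_field S x) = F (chart Phi x);

  standing_assumption :
    forall r, 0 <= r <= 1 ->
      0 < p S r /\ vsigma S r < 0 /\ p S r + vsigma S r < 0
}.

(** * Sections, global, local and return maps *)

(* Coordinates (v2, r, phi) on S_1 = {v1 = h}. *)
Definition section1 (h : R) (y : R3) : R4 :=
  let '(v2, r, phi) := y in (h, v2, r, phi).

(* Coordinates (v1, r, phi) on S_2 = {v2 = h}. *)
Definition section2 (h : R) (z : R3) : R4 :=
  let '(v1, r, phi) := z in (v1, h, r, phi).

(* G : S_1 -> S_2 is the lift to phi in R of the Poincare map along the
   channel, which meets S_1 in {v2 = 0} and S_2 in {v1 = 0}.  Being a Poincare
   map between transverse sections, it is a local diffeomorphism.  The side
   v2 > 0 is the one whose orbits come back to S_1, i.e. reach S_2 with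
   v1 > 0. *)
Record global_map (F Phi : R4 -> R4) (h : R) (G : R3 -> R3) : Prop := {
  global_analytic :
    forall r phi, 0 <= r <= 1 -> analytic_map3 G (0, r, phi);
  global_immersive :
    forall r phi, 0 <= r <= 1 -> injective_differential G (0, r, phi);
  global_channel :
    forall r phi, 0 <= r <= 1 ->
      exists r' phi', 0 <= r' <= 1 /\ G (0, r, phi) = (0, r', phi');
  global_flow :
    exists eps, 0 < eps /\
    forall v2 r phi, 0 <= v2 < eps -> 0 <= r <= 1 ->
      (exists (g : R -> R4) (T : R), 0 < T /\
         g 0 = chart Phi (section1 h (v2, r, phi)) /\
         g T = chart Phi (section2 h (G (v2, r, phi))) /\
         (forall t, 0 <= t <= T -> is_derive g t (F (g t)))) /\
      (exists (v1 r' phi' : R) (k : Z),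
         G (v2, r, phi) = (v1, r', phi') /\
         G (v2, r, phi + 1) = (v1, r', phi' + IZR k) /\
         (0 < v2 -> 0 < v1))
}.

(* The orbit of the point z of S_2 stays in the domain of the coordinates
   until it first meets S_1, at y. *)
Definition local_map (S : local_system) (delta h : R) (z y : R3) : Prop :=
  exists (g : R -> R4) (T : R), 0 < T /\
    g 0 = section2 h z /\ g T = section1 h y /\
    (forall t, 0 <= t <= T ->
       coord_domain delta (g t) /\ is_derive g t (local_field S (g t))) /\
    (forall t, 0 <= t < T -> let '(v1, _, _, _) := g t in v1 < h).

Definition return_map (S : local_system) (delta h : R) (G : R3 -> R3)
    (x y : R3) : Prop :=
  local_map S delta h (G x) y.

(* The asymptotic normal form of a (partial) map Q of (v2, r, phi), uniformly in
   (r, phi).  The conditions 0 < a1 and 0 <= b0 <= 1 make the real power and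
   p (b0), vsigma (b0), omega (b0) meaningful. *)
Definition has_normal_form (S : local_system) (h : R) (Q : R3 -> R3 -> Prop)
    : Prop :=
  exists a1 b0 c0 : R -> R -> R,
    (forall r phi, 0 <= r <= 1 ->
       0 < a1 r phi /\ 0 <= b0 r phi <= 1 /\
       a1 r (phi + 1) = a1 r phi /\
       b0 r (phi + 1) = b0 r phi /\
       c0 r (phi + 1) = c0 r phi) /\
    exists C eps, 0 < eps /\
      forall v2 r phi, 0 < v2 < eps -> 0 <= r <= 1 ->
        (exists y, Q (v2, r, phi) y) /\
        forall v2' r' phi', Q (v2, r, phi) (v2', r', phi') ->
          let b := b0 r phi in
          Rabs (v2' - h * Rpower (v2 * a1 r phi / h) (- vsigma S b / p S b))
            <= C * Rabs (v2 * ln v2) /\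
          Rabs (r' - b) <= C * v2 /\
          exists k : Z,
            Rabs (phi' - (c0 r phi - omega S b / p S b * ln (v2 / h)) - IZR k)
              <= C * Rabs (v2 * ln v2).

(* Main.v *)
Require Import Defs.
From Stdlib Require Import Reals ZArith Lra Lia Classical ClassicalEpsilon.
From Coquelicot Require Import Coquelicot.

(** An orbit that leaves the first section at small height [v2] reaches the second
    one with [v1 = xi], where [xi = v2 * a1 + O(v2^2)] because the channel is
    mapped to the channel; the slope [a1] is positive because the global map is
    an immersion and preserves the side [v2 > 0] ([slope_positive]). The radius
    and angle of the orbit there are [b0] and the angle of the channel orbit, up to [O(v2)]. These
    expansions come from dividing power series by [v2] ([analytic_at3_divide])
    and are uniform by compactness ([first_order_uniform]).

    During the passage near the center manifold the product [v1 * v2] satisfies a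
    linear equation with rate close to [p + vsigma < 0], so it decays
    exponentially from its initial value [xi * h] ([product_decays]). All coupling
    terms contain this product. Hence the radius moves by [O(xi)] in total
    ([radius_drift]), and up to an error [O(v2 * T)], where [T] is the time of
    passage, [ln v1] grows at rate [p b0] and the angle at rate [omega b0]
    ([logarithm_growth], [phase_growth]). Since [v1] runs from [xi] to [h], the time
    [T] is [ln (h / xi) / p b0] up to [O(v2 * ln v2)], which gives the angle of arrival
    ([phase_of_arrival]) with [c0] collecting the angle of the channel orbit and
    the term in [ln a1]. The height of arrival is at most [xi], because
    [h * v2 <= xi * h] there, and the power in the normal form has an exponent
    at least 1; both are therefore [O(v2)].

    These estimates hold for every orbit. That there is one follows from the
    global solution of a system that agrees with the given one in a box
    around the center manifold ([global_solution], [local_map_exists]): by the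
    same estimates its orbit stays in the box until it meets the section. *)

(** * Power series estimates *)

Lemma sum_n_diff_le (f g : nat -> R) (b : R) (n : nat) :
  (forall m, (m <= n)%nat -> Rabs (f m - g m) <= b) ->
  Rabs (sum_n f n - sum_n g n) <= (INR n + 1) * b.
Proof.
  induction n as [|n IH]; intros H.
  - rewrite !sum_O. simpl. rewrite Rplus_0_l, Rmult_1_l. apply H; lia.
  - rewrite !sum_Sn, S_INR. unfold plus; simpl.
    assert (H1 := IH (fun m Hm => H m (le_S _ _ Hm))).
    assert (H2 := H (S n) (le_n _)).
    replace (sum_n f n + f (S n) - (sum_n g n + g (S n)))
      with ((sum_n f n - sum_n g n) + (f (S n) - g (S n))) by ring.
    eapply Rle_trans; [apply Rabs_triang|]. lra.
Qed.

Lemma sum_n_zero (f : nat -> R) (n : nat) :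
  (forall m, (m <= n)%nat -> f m = 0) -> sum_n f n = 0.
Proof.
  induction n as [|n IH]; intros H; [rewrite sum_O; apply H; lia|].
  rewrite sum_Sn, IH, (H (S n)) by auto. unfold plus; simpl; ring.
Qed.

Lemma sum_n_first (f : nat -> R) (n : nat) :
  (forall m, (0 < m)%nat -> f m = 0) -> sum_n f n = f O.
Proof.
  intros H. induction n as [|n IH]; [now rewrite sum_O|].
  rewrite sum_Sn, IH, (H (S n)) by lia. unfold plus; simpl; ring.
Qed.

Lemma sum_n_shift (f : nat -> R) (n : nat) :
  sum_n f (S n) = f O + sum_n (fun m => f (S m)) n.
Proof.
  induction n as [|n IH].
  - rewrite sum_Sn, !sum_O. reflexivity.
  - rewrite sum_Sn, IH, sum_Sn. unfold plus; simpl; ring.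
Qed.

(** A product of [m] factors, each at most [s] in size and displaced by at most
    [B], moves by at most [m * s ^ (m - 1) * B]; the factor [s] on the left
    avoids the predecessor and makes the estimate stable under products. *)
Definition monomial_estimate (s B : R) (m : nat) (A A' : R) : Prop :=
  Rabs A <= s ^ m /\ Rabs A' <= s ^ m /\
  s * Rabs (A - A') <= INR m * s ^ m * B.

Lemma monomial_estimate_mult s B m n A A' C C' :
  0 <= s -> monomial_estimate s B m A A' -> monomial_estimate s B n C C' ->
  monomial_estimate s B (m + n) (A * C) (A' * C').
Proof.
  intros Hs (HA & HA' & HAA) (HC & HC' & HCC).
  unfold monomial_estimate. rewrite !Rabs_mult, pow_add, plus_INR.
  assert (0 <= s ^ m) by now apply pow_le.
  assert (0 <= s ^ n) by now apply pow_le.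
  repeat split.
  - apply Rmult_le_compat; auto using Rabs_pos.
  - apply Rmult_le_compat; auto using Rabs_pos.
  - replace (A * C - A' * C') with ((A - A') * C + A' * (C - C')) by ring.
    apply Rle_trans with (s * Rabs (A - A') * Rabs C + Rabs A' * (s * Rabs (C - C'))).
    { eapply Rle_trans; [apply Rmult_le_compat_l, Rabs_triang; lra|].
      rewrite !Rabs_mult. right; ring. }
    assert (0 <= s * Rabs (A - A')) by (apply Rmult_le_pos; auto using Rabs_pos).
    assert (0 <= s * Rabs (C - C')) by (apply Rmult_le_pos; auto using Rabs_pos).
    assert (s * Rabs (A - A') * Rabs C <= INR m * s ^ m * B * s ^ n)
      by (apply Rmult_le_compat; auto using Rabs_pos).
    assert (Rabs A' * (s * Rabs (C - C')) <= s ^ m * (INR n * s ^ n * B))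
      by (apply Rmult_le_compat; auto using Rabs_pos).
    lra.
Qed.

Lemma monomial_estimate_pow s B x y i :
  Rabs x <= s -> Rabs y <= s -> Rabs (x - y) <= B ->
  monomial_estimate s B i (x ^ i) (y ^ i).
Proof.
  intros Hx Hy HB.
  assert (Hs : 0 <= s) by (eapply Rle_trans; [apply Rabs_pos|eassumption]).
  induction i as [|i IH].
  - repeat split; simpl; rewrite ?Rabs_R1, ?Rminus_diag, ?Rabs_R0; lra.
  - change (monomial_estimate s B (1 + i) (x * x ^ i) (y * y ^ i)).
    apply monomial_estimate_mult; trivial.
    repeat split; simpl; rewrite ?Rmult_1_r, ?Rmult_1_l; trivial.
    now apply Rmult_le_compat_l.
Qed.

Lemma succ_le_pow2 (n : nat) : INR n + 1 <= 2 ^ n.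
Proof.
  induction n as [|n IH]; [simpl; lra|]. rewrite S_INR.
  change (2 ^ S n) with (2 * 2 ^ n). assert (0 <= INR n) by apply pos_INR. lra.
Qed.

(** The number of monomials of degree [n] grows polynomially, hence is absorbed
    by shrinking the radius by a factor of 32. *)
Lemma monomial_count (n : nat) :
  (INR n + 1) * ((INR n + 1) * ((INR n + 1) * ((INR n + 1) * (/ 32) ^ n)))
    <= (/ 2) ^ n.
Proof.
  assert (H := succ_le_pow2 n). assert (H0 := pos_INR n).
  assert (Hp : 0 < (/ 32) ^ n) by (apply pow_lt; lra).
  replace ((/ 2) ^ n) with (2 ^ n * (2 ^ n * (2 ^ n * (2 ^ n * (/ 32) ^ n)))).
  2:{ rewrite <- !Rpow_mult_distr. f_equal. field. }
  assert (G : forall u v, 0 <= u <= v -> 0 <= (INR n + 1) * u <= 2 ^ n * v).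
  { intros u v [Hu Huv]. split; [apply Rmult_le_pos; lra|].
    apply Rmult_le_compat; lra. }
  do 4 apply G. lra.
Qed.

Section Homogeneous.
Variables (c : nat -> nat -> nat -> nat -> R) (s M : R).
Hypothesis Hs : 0 < s.
Hypothesis Hc : forall i j k l,
  Rabs (c i j k l) * (32 * s) ^ (i + j + k + l) <= M.

Lemma coefficient_bound_nonneg : 0 <= M.
Proof.
  eapply Rle_trans; [|apply (Hc 0 0 0 0)]. simpl. rewrite Rmult_1_r.
  apply Rabs_pos.
Qed.

Lemma coefficient_bound i j k l :
  Rabs (c i j k l) * s ^ (i + j + k + l) <= M * (/ 32) ^ (i + j + k + l).
Proof.
  eapply Rle_trans; [|apply Rmult_le_compat_r, (Hc i j k l)].
  - rewrite Rmult_assoc, <- Rpow_mult_distr.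
    replace (32 * s * / 32) with s by field. lra.
  - apply pow_le; lra.
Qed.

(** Displacing the arguments by [B] changes the part of degree [n] by a term of
    a geometric series, so that the sum of the power series is Lipschitz on a
    smaller polydisc. *)
Lemma homogeneous_part_diff n x1 x2 x3 x4 y1 y2 y3 y4 B :
  Rabs x1 <= s -> Rabs x2 <= s -> Rabs x3 <= s -> Rabs x4 <= s ->
  Rabs y1 <= s -> Rabs y2 <= s -> Rabs y3 <= s -> Rabs y4 <= s ->
  Rabs (x1 - y1) <= B -> Rabs (x2 - y2) <= B ->
  Rabs (x3 - y3) <= B -> Rabs (x4 - y4) <= B ->
  Rabs (homogeneous_part c n x1 x2 x3 x4 - homogeneous_part c n y1 y2 y3 y4)
    <= M / s * B * (/ 2) ^ n.
Proof.
  intros X1 X2 X3 X4 Y1 Y2 Y3 Y4 D1 D2 D3 D4.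
  assert (HB : 0 <= B) by (eapply Rle_trans; [apply Rabs_pos|eassumption]).
  assert (HM := coefficient_bound_nonneg).
  assert (HMs : 0 <= M / s * B).
  { apply Rmult_le_pos; trivial. apply Rmult_le_pos; trivial.
    left; now apply Rinv_0_lt_compat. }
  assert (Hp : 0 <= (/ 32) ^ n) by (apply pow_le; lra).
  assert (Hn := pos_INR n).
  set (b := M / s * B * ((INR n + 1) * (/ 32) ^ n)).
  assert (Hb : 0 <= b) by (apply Rmult_le_pos; trivial; apply Rmult_le_pos; lra).
  apply Rle_trans with ((INR n + 1) * ((INR n + 1) * ((INR n + 1) * b))).
  2:{ unfold b. eapply Rle_trans; [|apply Rmult_le_compat_l, (monomial_count n);
        trivial]. right; ring. }
  assert (Hmono : forall m u, (m <= n)%nat -> 0 <= u ->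
            (INR m + 1) * u <= (INR n + 1) * u).
  { intros m u Hm Hu. apply Rmult_le_compat_r; trivial.
    apply le_INR in Hm. lra. }
  assert (Hb1 : 0 <= (INR n + 1) * b) by (apply Rmult_le_pos; lra).
  unfold homogeneous_part.
  apply sum_n_diff_le. intros i Hi.
  eapply Rle_trans; [|apply (Hmono (n - i)%nat); [lia|trivial]].
  apply sum_n_diff_le. intros j Hj.
  eapply Rle_trans; [|apply (Hmono (n - i - j)%nat); [lia|trivial]].
  apply sum_n_diff_le. intros k Hk.
  remember (n - i - j - k)%nat as l eqn:El.
  assert (En : n = (i + j + k + l)%nat) by lia.
  assert (HE : monomial_estimate s B (i + j + k + l)
     (x1 ^ i * x2 ^ j * x3 ^ k * x4 ^ l) (y1 ^ i * y2 ^ j * y3 ^ k * y4 ^ l)).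
  { repeat apply monomial_estimate_mult; try lra;
      apply monomial_estimate_pow; trivial. }
  destruct HE as (_ & _ & HE).
  assert (HC := coefficient_bound i j k l).
  rewrite <- En in HE, HC.
  set (X := x1 ^ i * x2 ^ j * x3 ^ k * x4 ^ l) in *.
  set (Y := y1 ^ i * y2 ^ j * y3 ^ k * y4 ^ l) in *.
  replace (c i j k l * x1 ^ i * x2 ^ j * x3 ^ k * x4 ^ l -
           c i j k l * y1 ^ i * y2 ^ j * y3 ^ k * y4 ^ l)
    with (c i j k l * (X - Y)) by (unfold X, Y; ring).
  rewrite Rabs_mult.
  apply Rmult_le_reg_l with s; trivial.
  apply Rle_trans with (Rabs (c i j k l) * (s * Rabs (X - Y))); [right; ring|].
  eapply Rle_trans; [apply Rmult_le_compat_l, HE; apply Rabs_pos|].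
  apply Rle_trans with (INR n * B * (Rabs (c i j k l) * s ^ n)); [right; ring|].
  eapply Rle_trans; [apply Rmult_le_compat_l, HC; apply Rmult_le_pos; lra|].
  unfold b.
  apply Rle_trans with ((INR n + 1) * (B * M * (/ 32) ^ n)).
  - replace (INR n * B * (M * (/ 32) ^ n)) with (INR n * (B * M * (/ 32) ^ n)) by ring.
    apply Rmult_le_compat_r; [repeat apply Rmult_le_pos; lra|lra].
  - right; field; lra.
Qed.

Lemma homogeneous_part_origin n :
  homogeneous_part c (S n) 0 0 0 0 = 0.
Proof.
  unfold homogeneous_part.
  apply sum_n_zero. intros i Hi. apply sum_n_zero. intros j Hj.
  apply sum_n_zero. intros k Hk.
  remember (S n - i - j - k)%nat as l eqn:El.
  destruct i as [|i]; [|simpl; ring].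
  destruct j as [|j]; [|simpl; ring].
  destruct k as [|k]; [|simpl; ring].
  destruct l as [|l]; [lia|simpl; ring].
Qed.

Lemma homogeneous_series_converges x1 x2 x3 x4 :
  Rabs x1 <= s -> Rabs x2 <= s -> Rabs x3 <= s -> Rabs x4 <= s ->
  ex_series (fun n => homogeneous_part c n x1 x2 x3 x4).
Proof.
  intros X1 X2 X3 X4.
  apply ex_series_incr_1.
  apply (ex_series_le (K := R_AbsRing) (V := R_CompleteNormedModule)) with
    (b := fun n => M / s * s * (/ 2) ^ S n).
  - intros n. change (Rabs (homogeneous_part c (S n) x1 x2 x3 x4)
                      <= M / s * s * (/ 2) ^ S n).
    rewrite <- (Rminus_0_r (homogeneous_part c (S n) x1 x2 x3 x4)).
    rewrite <- (homogeneous_part_origin n).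
    apply homogeneous_part_diff; rewrite ?Rminus_0_r, ?Rabs_R0; trivial; lra.
  - apply (ex_series_scal_l (K := R_AbsRing) (V := R_NormedModule) (M / s * s)).
    apply (ex_series_incr_1 (fun n => (/ 2) ^ n)).
    apply ex_series_geom. rewrite Rabs_pos_eq; lra.
Qed.

End Homogeneous.

Lemma series_diff_le (a b : nat -> R) (la lb K : R) :
  is_series a la -> is_series b lb ->
  (forall n, Rabs (a n - b n) <= K * (/ 2) ^ n) ->
  Rabs (la - lb) <= 2 * K.
Proof.
  intros Ha Hb H.
  assert (Hg : is_series (fun n => K * (/ 2) ^ n) (K * 2)).
  { apply (is_series_scal (K := R_AbsRing) (V := R_NormedModule) K).
    replace 2 with (/ (1 - / 2)) at 2 by field.
    apply is_series_geom. rewrite Rabs_pos_eq; lra. }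
  assert (Hd : is_series (fun n => a n - b n) (la - lb)).
  { apply (is_series_minus (K := R_AbsRing) (V := R_NormedModule)); trivial. }
  rewrite <- (is_series_unique _ _ Hd).
  eapply Rle_trans; [apply Series_Rabs|].
  - apply (ex_series_le (K := R_AbsRing) (V := R_CompleteNormedModule)) with
      (b := fun n => K * (/ 2) ^ n); [|eexists; exact Hg].
    intros n. change (Rabs (Rabs (a n - b n)) <= K * (/ 2) ^ n).
    rewrite Rabs_Rabsolu; apply H.
  - rewrite Rmult_comm, <- (is_series_unique _ _ Hg).
    apply Series_le; [|eexists; exact Hg].
    intros n; split; [apply Rabs_pos|apply H].
Qed.

(** * Local Lipschitz bounds for analytic functions *)

Definition near4 (B : R) (x y : R4) : Prop :=
  let '(x1, x2, x3, x4) := x in let '(y1, y2, y3, y4) := y in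
  Rabs (x1 - y1) <= B /\ Rabs (x2 - y2) <= B /\
  Rabs (x3 - y3) <= B /\ Rabs (x4 - y4) <= B.

(** One number [rho] serves as radius and, inverted, as bound and Lipschitz
    constant, so that a positive lower bound of [rho] over a compact set gives
    all three uniformly. *)
Definition lipschitz_near4 (f : R4 -> R) (rho : R) (a : R4) : Prop :=
  forall y z B, near4 rho y a -> near4 rho z a -> near4 B y z ->
    Rabs (f y) <= / rho /\ Rabs (f y - f z) <= B / rho.

Definition lipschitz_near1 (f : R -> R) (rho a : R) : Prop :=
  forall y z, Rabs (y - a) <= rho -> Rabs (z - a) <= rho ->
    Rabs (f y) <= / rho /\ Rabs (f y - f z) <= Rabs (y - z) / rho.

Lemma analytic_at4_lipschitz f a :
  analytic_at4 f a -> exists rho, 0 < rho /\ lipschitz_near4 f rho a.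
Proof.
  destruct a as [[[a1 a2] a3] a4]. intros (c & rho & M & Hrho & Hc & Hf).
  set (s := rho / 32).
  assert (Hs : 0 < s) by (unfold s; lra).
  assert (Hc0 := Hc); clear Hc.
  assert (Hc : forall i j k l, Rabs (c i j k l) * (32 * s) ^ (i + j + k + l) <= M).
  { intros. replace (32 * s) with rho by (unfold s; field). apply Hc0. }
  assert (HM := coefficient_bound_nonneg c s M Hc).
  assert (HL : forall y z B, near4 s y (a1, a2, a3, a4) ->
     near4 s z (a1, a2, a3, a4) -> near4 B y z ->
     Rabs (f y - f z) <= 2 * (M / s * B)).
  { intros [[[y1 y2] y3] y4] [[[z1 z2] z3] z4] B
      (Y1 & Y2 & Y3 & Y4) (Z1 & Z2 & Z3 & Z4) (D1 & D2 & D3 & D4).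
    eapply series_diff_le.
    1,2: apply Hf; unfold s in *; lra.
    intros n. cbv beta. apply (homogeneous_part_diff c s M Hs Hc).
    all: match goal with |- Rabs (?u - ?v - (?w - ?v)) <= _ =>
      replace (u - v - (w - v)) with (u - w) by ring; assumption | _ => assumption end. }
  set (a := (a1, a2, a3, a4)) in *.
  assert (Ha := Rabs_pos (f a)).
  assert (Hsi : 0 < / s) by now apply Rinv_0_lt_compat.
  assert (HMs : 0 <= M / s) by (apply Rmult_le_pos; lra).
  (* The summands bound f, its Lipschitz constant and the inverse radius. *)
  set (N := Rabs (f a) + 2 * M + 2 * (M / s) + / s).
  assert (HN : / s <= N) by (unfold N; lra).
  exists (/ N). split; [apply Rinv_0_lt_compat; lra|].
  assert (HNs : / N <= s).
  { rewrite <- (Rinv_inv s). apply Rinv_le_contravar; lra. }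
  assert (Hnear : forall y, near4 (/ N) y a -> near4 s y a).
  { intros [[[y1 y2] y3] y4] (Y1 & Y2 & Y3 & Y4). repeat split; lra. }
  intros y z B Hy Hz HB. apply Hnear in Hy. apply Hnear in Hz.
  unfold Rdiv; rewrite Rinv_inv.
  assert (HB0 : 0 <= B).
  { destruct y as [[[? ?] ?] ?], z as [[[? ?] ?] ?]. destruct HB as [HB _].
    eapply Rle_trans; [apply Rabs_pos|exact HB]. }
  split.
  - assert (Haa : near4 s a a).
    { unfold a. repeat split; rewrite Rminus_diag, Rabs_R0; lra. }
    assert (H := HL y a s Hy Haa Hy).
    replace (2 * (M / s * s)) with (2 * M) in H by (field; lra).
    replace (f y) with (f a + (f y - f a)) by ring.
    eapply Rle_trans; [apply Rabs_triang|]. unfold N; lra.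
  - eapply Rle_trans; [apply HL; eauto|].
    replace (2 * (M / s * B)) with (B * (2 * (M / s))) by ring.
    apply Rmult_le_compat_l; trivial. unfold N; lra.
Qed.

Lemma analytic_at1_lipschitz f a :
  analytic_at1 f a -> exists rho, 0 < rho /\ lipschitz_near1 f rho a.
Proof.
  intros (c & rho & Hrho & Hf).
  set (s := rho / 64).
  assert (Hs : 0 < s) by (unfold s; lra).
  (* The general term of a convergent series is bounded. *)
  assert (HM : exists M, forall n, Rabs (c n) * (32 * s) ^ n <= M).
  { assert (Hx := Hf (a + 32 * s)).
    replace (a + 32 * s - a) with (32 * s) in Hx by ring.
    assert (H0 : is_lim_seq (fun n => scal (pow_n (32 * s) n) (c n)) 0).
    { apply ex_series_lim_0. eexists. apply Hx. rewrite Rabs_pos_eq;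
        unfold s; lra. }
    apply is_lim_seq_spec in H0. destruct (H0 (mkposreal 1 Rlt_0_1)) as [N HN].
    assert (Hfin : forall m, exists M, forall n, (n < m)%nat ->
                     Rabs (c n) * (32 * s) ^ n <= M).
    { induction m as [|m [M IH]]; [exists 0; lia|].
      exists (Rmax M (Rabs (c m) * (32 * s) ^ m)). intros n Hn.
      destruct (Nat.eq_dec n m) as [->|Hne]; [apply Rmax_r|].
      eapply Rle_trans; [apply IH; lia|apply Rmax_l]. }
    destruct (Hfin N) as [M HMN]. exists (Rmax M 1). intros n.
    destruct (Nat.lt_ge_cases n N) as [Hn|Hn].
    - eapply Rle_trans; [now apply HMN|apply Rmax_l].
    - specialize (HN n Hn). rewrite pow_n_pow, Rminus_0_r in HN.
      unfold scal in HN; simpl in HN; unfold mult in HN; simpl in HN.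
      rewrite Rabs_mult, Rabs_pos_eq in HN by (apply pow_le; lra).
      eapply Rle_trans; [|apply Rmax_r]. rewrite Rmult_comm. now left. }
  destruct HM as [M HM].
  assert (HM0 : 0 <= M).
  { eapply Rle_trans; [|apply (HM O)]. simpl. rewrite Rmult_1_r. apply Rabs_pos. }
  assert (Hsi : 0 < / s) by now apply Rinv_0_lt_compat.
  assert (HMs : 0 <= M / s) by (apply Rmult_le_pos; lra).
  assert (HL : forall y z, Rabs (y - a) <= s -> Rabs (z - a) <= s ->
     Rabs (f y - f z) <= 2 * (M / s * Rabs (y - z))).
  { intros y z Hy Hz.
    eapply series_diff_le.
    1,2: apply Hf; unfold s in *; lra.
    intros n. rewrite !pow_n_pow. unfold scal; simpl; unfold mult; simpl.
    assert (HE : monomial_estimate s (Rabs (y - z)) n ((y - a) ^ n) ((z - a) ^ n)).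
    { apply monomial_estimate_pow; trivial.
      replace (y - a - (z - a)) with (y - z) by ring. lra. }
    destruct HE as (_ & _ & HE).
    rewrite <- Rmult_minus_distr_r, Rabs_mult.
    apply Rmult_le_reg_l with s; trivial.
    rewrite <- Rmult_assoc.
    eapply Rle_trans; [apply Rmult_le_compat_r, HE; apply Rabs_pos|].
    assert (Hn := pos_INR n). assert (HD := Rabs_pos (y - z)).
    assert (HC : Rabs (c n) * s ^ n <= M * (/ 32) ^ n).
    { eapply Rle_trans; [|apply Rmult_le_compat_r, (HM n); apply pow_le; lra].
      rewrite Rmult_assoc, <- Rpow_mult_distr.
      replace (32 * s * / 32) with s by field. lra. }
    apply Rle_trans with (INR n * Rabs (y - z) * (M * (/ 32) ^ n)).
    { eapply Rle_trans; [|apply Rmult_le_compat_l, HC; apply Rmult_le_pos; lra].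
      right; ring. }
    assert (Hp : 0 < (/ 32) ^ n) by (apply pow_lt; lra).
    assert (HG : INR n * (/ 32) ^ n <= (/ 2) ^ n).
    { eapply Rle_trans; [|apply (monomial_count n)].
      assert (G : forall u v, 0 <= u <= v -> 0 <= u <= (INR n + 1) * v).
      { intros u v [Hu Huv]. split; trivial. rewrite <- (Rmult_1_l u).
        apply Rmult_le_compat; lra. }
      do 3 apply G. split; [apply Rmult_le_pos; lra|].
      apply Rmult_le_compat_r; lra. }
    apply Rle_trans with (M * Rabs (y - z) * (INR n * (/ 32) ^ n)); [right; ring|].
    eapply Rle_trans; [apply Rmult_le_compat_l, HG; now apply Rmult_le_pos|].
    right; field; lra. }
  assert (Ha := Rabs_pos (f a)).
  (* The summands bound f, its Lipschitz constant and the inverse radius. *)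
  set (N := Rabs (f a) + 2 * M + 2 * (M / s) + / s).
  assert (HN : / s <= N) by (unfold N; lra).
  exists (/ N). split; [apply Rinv_0_lt_compat; lra|].
  assert (HNs : / N <= s).
  { rewrite <- (Rinv_inv s). apply Rinv_le_contravar; lra. }
  intros y z Hy Hz. unfold Rdiv; rewrite Rinv_inv.
  assert (HD := Rabs_pos (y - z)). split.
  - assert (H := HL y a ltac:(lra)).
    rewrite Rminus_diag, Rabs_R0 in H. specialize (H (Rlt_le _ _ Hs)).
    assert (M / s * Rabs (y - a) <= M).
    { apply Rle_trans with (M / s * s); [apply Rmult_le_compat_l; lra|].
      right; field; lra. }
    replace (f y) with (f a + (f y - f a)) by ring.
    eapply Rle_trans; [apply Rabs_triang|]. unfold N; lra.
  - eapply Rle_trans; [apply HL; lra|].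
    replace (2 * (M / s * Rabs (y - z))) with (Rabs (y - z) * (2 * (M / s))) by ring.
    apply Rmult_le_compat_l; trivial. unfold N; lra.
Qed.

(** * Dividing by the first variable *)

Definition shift_coefficients (c : nat -> nat -> nat -> nat -> R) :=
  fun i j k l => c i (S j) k l.

Lemma homogeneous_part_first_zero c n v u w :
  homogeneous_part c n 0 v u w =
  sum_n (fun j => sum_n (fun k =>
    c O j k (n - j - k)%nat * v ^ j * u ^ k * w ^ (n - j - k)) (n - j)) n.
Proof.
  unfold homogeneous_part. rewrite sum_n_first.
  - rewrite Nat.sub_0_r. apply sum_n_ext; intros j. apply sum_n_ext; intros k.
    simpl. ring.
  - intros [|i] Hi; [lia|].
    apply sum_n_zero; intros j _. apply sum_n_zero; intros k _. simpl. ring.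
Qed.

Lemma sum_n_mult (v : R) (f : nat -> R) n :
  sum_n (fun k => v * f k) n = v * sum_n f n.
Proof. exact (sum_n_mult_l (K := R_Ring) v f n). Qed.

Lemma homogeneous_part_shift c n v u w :
  homogeneous_part c (S n) 0 v u w - homogeneous_part c (S n) 0 0 u w =
  v * homogeneous_part (shift_coefficients c) n 0 v u w.
Proof.
  rewrite !homogeneous_part_first_zero, !sum_n_shift.
  rewrite (sum_n_zero (fun m => sum_n (fun k => c O (S m) k (S n - S m - k)%nat
             * 0 ^ S m * u ^ k * w ^ (S n - S m - k)) (S n - S m))).
  2:{ intros m _. apply sum_n_zero; intros k _. simpl; ring. }
  rewrite <- sum_n_mult.
  match goal with |- ?a + ?s - (?b + 0) = ?r => cut (s = r) end.
  { intros ->. rewrite !pow_O. ring. }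
  apply sum_n_ext; intros j. rewrite <- sum_n_mult.
  apply sum_n_ext; intros k. unfold shift_coefficients. simpl. ring.
Qed.

Definition near3 (B : R) (x y : R3) : Prop :=
  let '(x1, x2, x3) := x in let '(y1, y2, y3) := y in
  Rabs (x1 - y1) <= B /\ Rabs (x2 - y2) <= B /\ Rabs (x3 - y3) <= B.

(** Dividing the monomials that contain the first variable by it leaves again
    an absolutely convergent power series, the quotient [q]. *)
Lemma analytic_at3_divide f r0 phi0 :
  analytic_at3 f (0, r0, phi0) ->
  exists (q : R3 -> R) (rho : R), 0 < rho /\
    (forall v r phi, near3 rho (v, r, phi) (0, r0, phi0) ->
       f (v, r, phi) - f (0, r, phi) = v * q (v, r, phi)) /\
    (forall y z B, near3 rho y (0, r0, phi0) -> near3 rho z (0, r0, phi0) ->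
       near3 B y z -> Rabs (q y - q z) <= B / rho).
Proof.
  intros (c & rho & M & Hrho & Hc & Hf).
  set (s := rho / 32).
  assert (Hs : 0 < s) by (unfold s; lra).
  set (c' := shift_coefficients c).
  assert (Hc' : forall i j k l,
            Rabs (c' i j k l) * (32 * s) ^ (i + j + k + l) <= M / rho).
  { intros. replace (32 * s) with rho by (unfold s; field).
    apply Rmult_le_reg_l with rho; trivial.
    replace (rho * (M / rho)) with M by (field; lra).
    eapply Rle_trans; [|apply (Hc i (S j) k l)]. right.
    replace (i + S j + k + l)%nat with (S (i + j + k + l)) by lia.
    unfold c', shift_coefficients. simpl. ring. }
  assert (HM := coefficient_bound_nonneg c' s (M / rho) Hc').
  pose (q := fun x : R3 => let '(v, r, phi) := x in
    Series (fun n => homogeneous_part c' n 0 v (r - r0) (phi - phi0))).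
  assert (Hq : forall v r phi, near3 s (v, r, phi) (0, r0, phi0) ->
     is_series (fun n => homogeneous_part c' n 0 v (r - r0) (phi - phi0))
       (q (v, r, phi))).
  { intros v r phi (Hv & Hr & Hp). rewrite Rminus_0_r in Hv.
    apply Series_correct.
    apply (homogeneous_series_converges c' s (M / rho) Hs Hc'); trivial.
    rewrite Rabs_R0; lra. }
  assert (Hsi : 0 < / s) by now apply Rinv_0_lt_compat.
  assert (HMs : 0 <= M / rho / s) by (apply Rmult_le_pos; lra).
  set (N := 2 * (M / rho / s) + / s).
  assert (HN : / s <= N) by (unfold N; lra).
  assert (HNs : / N <= s).
  { rewrite <- (Rinv_inv s). apply Rinv_le_contravar; lra. }
  assert (Hnear : forall y, near3 (/ N) y (0, r0, phi0) -> near3 s y (0, r0, phi0)).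
  { intros [[y1 y2] y3] (Y1 & Y2 & Y3). repeat split; lra. }
  exists q, (/ N). split; [apply Rinv_0_lt_compat; lra|]. split.
  - intros v r phi Hx. apply Hnear in Hx. assert (Hqx := Hq _ _ _ Hx).
    destruct Hx as (Hv & Hr & Hp).
    assert (Hx : forall u, Rabs u <= s -> is_series
      (fun n => homogeneous_part c n 0 u (r - r0) (phi - phi0)) (f (u, r, phi))).
    { intros u Hu. assert (H := Hf 0 u r phi). rewrite Rminus_diag, Rminus_0_r in H.
      apply H; rewrite ?Rabs_R0; unfold s in *; lra. }
    rewrite Rminus_0_r in Hv.
    assert (H0 : Rabs 0 <= s) by (rewrite Rabs_R0; lra).
    assert (Hd := is_series_minus (K := R_AbsRing) (V := R_NormedModule)
                    _ _ _ _ (Hx v Hv) (Hx 0 H0)).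
    assert (Hd' := is_series_scal (K := R_AbsRing) (V := R_NormedModule) v _ _ Hqx).
    assert (He : is_series (fun n => plus
                (homogeneous_part c n 0 v (r - r0) (phi - phi0))
                (opp (homogeneous_part c n 0 0 (r - r0) (phi - phi0))))
                (v * q (v, r, phi))).
    { apply is_series_decr_1. unfold plus, opp; simpl.
      match goal with |- is_series _ (?a + - ?b) => replace b with 0 end.
      2:{ rewrite !homogeneous_part_first_zero, !sum_O.
          simpl. ring. }
      rewrite Ropp_0, Rplus_0_r.
      eapply is_series_ext; [|exact Hd'].
      intros n. symmetry. apply homogeneous_part_shift. }
    rewrite <- (is_series_unique _ _ He). symmetry. exact (is_series_unique _ _ Hd).
  - intros [[y1 y2] y3] [[z1 z2] z3] B Hy Hz HB.
    apply Hnear in Hy. apply Hnear in Hz.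
    apply Rle_trans with (2 * (M / rho / s * B)).
    + eapply series_diff_le; [now apply Hq|now apply Hq|].
      intros n. cbv beta. destruct Hy as (Y1 & Y2 & Y3), Hz as (Z1 & Z2 & Z3).
      destruct HB as (D1 & D2 & D3). rewrite Rminus_0_r in Y1, Z1.
      assert (0 <= B) by (eapply Rle_trans; [apply Rabs_pos|exact D1]).
      apply (homogeneous_part_diff c' s (M / rho) Hs Hc'); trivial;
        rewrite ?Rminus_diag, ?Rabs_R0; trivial; try lra.
      * replace (y2 - r0 - (z2 - r0)) with (y2 - z2) by ring; trivial.
      * replace (y3 - phi0 - (z3 - phi0)) with (y3 - z3) by ring; trivial.
    + unfold Rdiv at 3. rewrite Rinv_inv.
      assert (0 <= B) by (destruct HB as [HB _]; eapply Rle_trans;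
                          [apply Rabs_pos|exact HB]).
      replace (2 * (M / rho / s * B)) with (B * (2 * (M / rho / s))) by ring.
      apply Rmult_le_compat_l; trivial. unfold N; lra.
Qed.

(** * Compactness *)

(** If the property gets weaker as its size shrinks and has some size near each
    point of a compact box, then a single size works on the whole box. *)
Lemma compact_uniform_size (n : nat) (a b : Compactness.Tn n R)
    (Q : R -> Compactness.Tn n R -> Prop) :
  (forall x, bounded_n n a b x ->
     exists rho, 0 < rho /\ forall y, close_n n rho y x -> Q rho y) ->
  (forall rho rho' x, 0 < rho' <= rho -> Q rho x -> Q rho' x) ->
  exists d, 0 < d /\ forall x, bounded_n n a b x -> Q d x.
Proof.
  intros Hloc Hmono.
  assert (H : forall x, exists rho : posreal, bounded_n n a b x ->
                forall y, close_n n rho y x -> Q rho y).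
  { intros x. destruct (excluded_middle_informative (bounded_n n a b x)) as [Hx|Hx].
    - destruct (Hloc x Hx) as (rho & Hrho & HQ).
      exists (mkposreal rho Hrho). intros _. exact HQ.
    - (* Any size will do at the points outside the box. *)
      exists (mkposreal 1 Rlt_0_1). contradiction. }
  pose (delta := fun x => proj1_sig (constructive_indefinite_description _ (H x))).
  destruct (compactness_value n a b delta) as [d Hd].
  exists d. split; [apply cond_pos|]. intros x Hx.
  apply NNPP. intros Hn. apply (Hd x Hx). intros (t & Ht & Hxt & Hle).
  apply Hn. apply Hmono with (delta t); [split; [apply cond_pos|exact Hle]|].
  exact (proj2_sig (constructive_indefinite_description _ (H t)) Ht x Hxt).
Qed.

(** * Limits with a geometric error *)

Lemma le_of_geometric_error (x y C : R) :
  (forall n, x <= y + C * (/ 2) ^ n) -> x <= y.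
Proof.
  intros H.
  assert (Hl : is_lim_seq (fun n => y + C * (/ 2) ^ n) (y + C * 0)).
  { apply is_lim_seq_plus'; [apply is_lim_seq_const|].
    apply (is_lim_seq_scal_l _ C 0), is_lim_seq_geom. rewrite Rabs_pos_eq; lra. }
  rewrite Rmult_0_r, Rplus_0_r in Hl.
  exact (is_lim_seq_le _ _ (Finite x) (Finite y) H (is_lim_seq_const x) Hl).
Qed.

Lemma geometric_cauchy_limit (a : nat -> R) (C : R) :
  (forall n, Rabs (a (S n) - a n) <= C * (/ 2) ^ n) ->
  forall n, Rabs (real (Lim_seq a) - a n) <= 2 * C * (/ 2) ^ n.
Proof.
  intros H.
  assert (HC : 0 <= C).
  { generalize (H O), (Rabs_pos (a 1%nat - a 0%nat)). simpl. lra. }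
  assert (Hk : forall n k, Rabs (a (n + k)%nat - a n) <= 2 * C * (/ 2) ^ n).
  { intros n k.
    apply Rle_trans with (2 * C * (/ 2) ^ n * (1 - (/ 2) ^ k)).
    - induction k as [|k IH].
      + rewrite Nat.add_0_r, Rminus_diag, Rabs_R0. simpl. lra.
      + rewrite Nat.add_succ_r. assert (Hn := H (n + k)%nat).
        rewrite pow_add in Hn.
        replace (a (S (n + k)) - a n)
          with ((a (S (n + k)) - a (n + k)%nat) + (a (n + k)%nat - a n)) by ring.
        eapply Rle_trans; [apply Rabs_triang|]. simpl. lra.
    - assert (0 < (/ 2) ^ k) by (apply pow_lt; lra).
      assert (0 < (/ 2) ^ n) by (apply pow_lt; lra).
      rewrite <- (Rmult_1_r (2 * C * (/ 2) ^ n)) at 2.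
      apply Rmult_le_compat_l; [|lra]. apply Rmult_le_pos; lra. }
  assert (Hl : is_lim_seq (fun n => 2 * C * (/ 2) ^ n) (2 * C * 0)).
  { apply (is_lim_seq_scal_l _ (2 * C) 0), is_lim_seq_geom.
    rewrite Rabs_pos_eq; lra. }
  rewrite Rmult_0_r in Hl. apply is_lim_seq_spec in Hl.
  assert (Hc : ex_finite_lim_seq a).
  { apply ex_lim_seq_cauchy_corr. intros eps.
    destruct (Hl (mkposreal (eps / 2) (is_pos_div_2 eps))) as [N HN].
    exists N. intros n m Hn Hm. specialize (HN N (le_n _)). simpl in HN.
    rewrite Rminus_0_r, Rabs_pos_eq in HN.
    2:{ apply Rmult_le_pos; [lra|apply pow_le; lra]. }
    assert (H1 := Hk N (n - N)%nat). assert (H2 := Hk N (m - N)%nat).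
    replace (N + (n - N))%nat with n in H1 by lia.
    replace (N + (m - N))%nat with m in H2 by lia.
    replace (a n - a m) with ((a n - a N) - (a m - a N)) by ring.
    eapply Rle_lt_trans; [apply Rabs_triang|]. rewrite Rabs_Ropp. lra. }
  apply Lim_seq_correct' in Hc. intros n.
  assert (Ha : is_lim_seq (fun k => Rabs (a (k + n)%nat - a n))
                 (Rabs (real (Lim_seq a) - a n))).
  { apply (is_lim_seq_abs _ (Finite (real (Lim_seq a) - a n))).
    apply is_lim_seq_minus'; [|apply is_lim_seq_const].
    exact (proj1 (is_lim_seq_incr_n a n _) Hc). }
  refine (is_lim_seq_le _ _ (Finite _) (Finite _) _ Ha (is_lim_seq_const _)).
  intros k. rewrite Nat.add_comm. apply Hk.
Qed.

Lemma lipschitz_continuous (g : R -> R) (C : R) :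
  (forall s t, Rabs (g s - g t) <= C * Rabs (s - t)) ->
  forall t, continuous g t.
Proof.
  intros H t. apply filterlim_locally. intros eps.
  assert (Hd : 0 < Rabs C + 1) by (generalize (Rabs_pos C); lra).
  exists (mkposreal (eps / (Rabs C + 1)) (Rdiv_lt_0_compat _ _ (cond_pos eps) Hd)).
  intros s Hs. change (Rabs (g s - g t) < eps). change (Rabs (s - t) <
    eps / (Rabs C + 1)) in Hs.
  assert (Hs' : Rabs (s - t) * (Rabs C + 1) < eps).
  { apply Rmult_lt_compat_r with (r := Rabs C + 1) in Hs; trivial.
    unfold Rdiv in Hs. rewrite Rmult_assoc, Rinv_l in Hs by lra. lra. }
  eapply Rle_lt_trans; [apply H|]. eapply Rle_lt_trans; [|exact Hs'].
  rewrite Rmult_comm. apply Rmult_le_compat_l; [apply Rabs_pos|].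
  generalize (Rle_abs C); lra.
Qed.

(** * Global existence for bounded Lipschitz systems *)

Section Picard.

(** The unknowns are indexed by an arbitrary type and measured in the sup norm,
    written out as a common bound on all components. *)
Variables (I : Type) (f : I -> (I -> R) -> R) (K M : R) (x0 : I -> R).
Hypothesis K_pos : 0 < K.
Hypothesis f_bounded : forall i x, Rabs (f i x) <= M.
Hypothesis f_lipschitz : forall x y B,
  (forall j, Rabs (x j - y j) <= B) ->
  forall i, Rabs (f i x - f i y) <= K * B.

Definition M_lipschitz (u : R -> I -> R) : Prop :=
  forall i s t, Rabs (u s i - u t i) <= M * Rabs (s - t).

Definition picard_step (u : R -> I -> R) (t : R) (i : I) : R :=
  x0 i + RInt (fun s => f i (u s)) 0 t.

Fixpoint picard_iterate (n : nat) : R -> I -> R :=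
  match n with
  | O => fun _ => x0
  | S m => picard_step (picard_iterate m)
  end.

Lemma integrand_continuous u i t :
  M_lipschitz u -> continuous (fun s => f i (u s)) t.
Proof.
  intros Hu. apply lipschitz_continuous with (K * M). intros s r.
  rewrite Rmult_assoc. apply f_lipschitz. intros j. apply Hu.
Qed.

Lemma integrand_integrable u i a b :
  M_lipschitz u -> ex_RInt (fun s => f i (u s)) a b.
Proof.
  intros Hu. apply (ex_RInt_continuous (V := R_CompleteNormedModule)).
  intros z _. now apply integrand_continuous.
Qed.

Lemma picard_step_lipschitz u : M_lipschitz u -> M_lipschitz (picard_step u).
Proof.
  intros Hu i s t. unfold picard_step.
  assert (HC := RInt_Chasles (V := R_CompleteNormedModule) _ _ _ _
    (integrand_integrable u i 0 t Hu) (integrand_integrable u i t s Hu)).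
  rewrite <- HC. unfold plus; simpl.
  assert (E : forall x a b : R, x + (a + b) - (x + a) = b) by (intros; ring).
  rewrite E.
  rewrite Rmult_comm.
  apply (norm_RInt_le_const_abs (V := R_NormedModule) (fun s => f i (u s)) t s).
  - intros; apply f_bounded.
  - apply (RInt_correct (V := R_CompleteNormedModule)).
    now apply integrand_integrable.
Qed.

Lemma M_nonneg (i : I) : 0 <= M.
Proof. eapply Rle_trans; [apply Rabs_pos|apply (f_bounded i x0)]. Qed.

Lemma picard_iterate_lipschitz n : M_lipschitz (picard_iterate n).
Proof.
  induction n as [|n IH].
  - intros i s t. simpl. rewrite Rminus_diag, Rabs_R0.
    apply Rmult_le_pos; [apply (M_nonneg i)|apply Rabs_pos].
  - now apply picard_step_lipschitz.
Qed.

(** With the weight [exp (2 * K * t)] the step halves distances on the whole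
    half line, which makes the solution global without any gluing. *)
Lemma picard_step_contracts u u' D :
  M_lipschitz u -> M_lipschitz u' ->
  (forall i t, 0 <= t -> Rabs (u t i - u' t i) <= D * exp (2 * K * t)) ->
  forall i t, 0 <= t ->
    Rabs (picard_step u t i - picard_step u' t i) <= D / 2 * exp (2 * K * t).
Proof.
  intros Hu Hu' H i t Ht. unfold picard_step.
  assert (HD : 0 <= D).
  { assert (H0 := H i 0 (Rle_refl 0)). rewrite Rmult_0_r, exp_0, Rmult_1_r in H0.
    eapply Rle_trans; [apply Rabs_pos|exact H0]. }
  assert (E : forall x a b : R, x + a - (x + b) = minus a b)
    by (intros; unfold minus, plus, opp; simpl; ring).
  rewrite E.
  rewrite <- (RInt_minus (V := R_CompleteNormedModule)) by
    now apply integrand_integrable.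
  apply Rle_trans with (minus (D / 2 * exp (2 * K * t)) (D / 2 * exp (2 * K * 0))).
  2:{ rewrite Rmult_0_r, exp_0. unfold minus, plus, opp; simpl. lra. }
  apply (norm_RInt_le (V := R_NormedModule)
           (fun s => minus (f i (u s)) (f i (u' s)))
           (fun s => K * (D * exp (2 * K * s))) 0 t); trivial.
  - intros s Hs. change (Rabs (f i (u s) - f i (u' s)) <= K * (D * exp (2 * K * s))).
    apply f_lipschitz. intros j. apply H. lra.
  - apply (RInt_correct (V := R_CompleteNormedModule)).
    apply (ex_RInt_minus (V := R_NormedModule)); now apply integrand_integrable.
  - apply (is_RInt_derive (V := R_CompleteNormedModule)
             (fun s => D / 2 * exp (2 * K * s))).
    + intros s _. auto_derive; trivial. field.
    + intros s _. apply (ex_derive_continuous (V := R_NormedModule)).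
      auto_derive; trivial.
Qed.

Lemma picard_iterate_cauchy n i t :
  0 <= t ->
  Rabs (picard_iterate (S n) t i - picard_iterate n t i)
    <= M / (2 * K) * exp (2 * K * t) * (/ 2) ^ n.
Proof.
  revert i t. induction n as [|n IH]; intros i t Ht.
  - assert (H := picard_step_lipschitz _ (picard_iterate_lipschitz 0) i t 0).
    assert (E : picard_step (picard_iterate 0) 0 i = picard_iterate 0 t i).
    { unfold picard_step. rewrite (RInt_point (V := R_CompleteNormedModule)).
      apply Rplus_0_r. }
    rewrite E in H. eapply Rle_trans; [exact H|].
    rewrite Rminus_0_r, Rabs_pos_eq by trivial. simpl. rewrite Rmult_1_r.
    apply Rle_trans with (M / (2 * K) * (2 * K * t)); [right; field; lra|].
    apply Rmult_le_compat_l.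
    + apply Rmult_le_pos; [apply (M_nonneg i)|]. left; apply Rinv_0_lt_compat; lra.
    + generalize (exp_ineq1_le (2 * K * t)); lra.
  - replace (M / (2 * K) * exp (2 * K * t) * (/ 2) ^ S n)
      with (M / (2 * K) * (/ 2) ^ n / 2 * exp (2 * K * t)) by (simpl; field; lra).
    apply (picard_step_contracts (picard_iterate (S n)) (picard_iterate n));
      trivial; try apply picard_iterate_lipschitz.
    intros j s Hs. eapply Rle_trans; [now apply IH|]. right; ring.
Qed.

(** The limit is frozen for negative times: there the step then produces a
    straight segment, so that the solution is differentiable at time [0]. *)
Definition picard_limit (t : R) (i : I) : R :=
  real (Lim_seq (fun n => picard_iterate n (Rmax t 0) i)).

Lemma picard_limit_error n i t :
  0 <= t ->
  Rabs (picard_limit t i - picard_iterate n t i)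
    <= M / K * exp (2 * K * t) * (/ 2) ^ n.
Proof.
  intros Ht. unfold picard_limit. rewrite Rmax_left by trivial.
  replace (M / K * exp (2 * K * t)) with (2 * (M / (2 * K) * exp (2 * K * t)))
    by (field; lra).
  apply (geometric_cauchy_limit (fun n => picard_iterate n t i)).
  intros m. now apply picard_iterate_cauchy.
Qed.

Lemma picard_limit_lipschitz : M_lipschitz picard_limit.
Proof.
  assert (H : forall i s t, 0 <= s -> 0 <= t ->
     Rabs (picard_limit s i - picard_limit t i) <= M * Rabs (s - t)).
  { intros i s t Hs Ht.
    apply le_of_geometric_error with
      (M / K * exp (2 * K * s) + M / K * exp (2 * K * t)).
    intros n.
    assert (H1 := picard_limit_error n i s Hs).
    assert (H2 := picard_limit_error n i t Ht).
    assert (H3 := picard_iterate_lipschitz n i s t).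
    set (a := picard_limit s i) in *. set (b := picard_limit t i) in *.
    set (a' := picard_iterate n s i) in *. set (b' := picard_iterate n t i) in *.
    replace (a - b) with ((a - a') + (a' - b') - (b - b')) by ring.
    eapply Rle_trans; [apply Rabs_triang|]. rewrite Rabs_Ropp.
    generalize (Rabs_triang (a - a') (a' - b')). lra. }
  intros i s t.
  assert (E : forall r, picard_limit r i = picard_limit (Rmax r 0) i).
  { intros r. unfold picard_limit. now rewrite (Rmax_left (Rmax r 0) 0) by apply Rmax_r. }
  rewrite (E s), (E t).
  eapply Rle_trans; [apply H; apply Rmax_r|].
  apply Rmult_le_compat_l; [apply (M_nonneg i)|].
  unfold Rmax. destruct (Rle_dec s 0), (Rle_dec t 0);
    repeat (unfold Rabs; destruct (Rcase_abs _)); lra.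
Qed.

Lemma picard_limit_fixed i t :
  0 <= t -> picard_step picard_limit t i = picard_limit t i.
Proof.
  intros Ht. apply Rminus_diag_uniq.
  assert (H : Rabs (picard_step picard_limit t i - picard_limit t i) <= 0).
  { apply le_of_geometric_error with (M / K * exp (2 * K * t)). intros n.
    assert (H1 := picard_limit_error (S n) i t Ht).
    assert (H2 := picard_step_contracts picard_limit (picard_iterate n)
      (M / K * (/ 2) ^ n) picard_limit_lipschitz (picard_iterate_lipschitz n)).
    assert (H3 : Rabs (picard_step picard_limit t i - picard_iterate (S n) t i)
       <= M / K * (/ 2) ^ n / 2 * exp (2 * K * t)).
    { apply H2; trivial. intros j s Hs.
      eapply Rle_trans; [now apply picard_limit_error|]. right; ring. }
    set (a := picard_step picard_limit t i) in *. set (b := picard_limit t i) in *.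
    set (c := picard_iterate (S n) t i) in *.
    replace (a - b) with ((a - c) - (b - c)) by ring.
    eapply Rle_trans; [apply Rabs_triang|]. rewrite Rabs_Ropp. simpl in H1.
    lra. }
  generalize (Rabs_pos (picard_step picard_limit t i - picard_limit t i)).
  intros H0. apply Rabs_eq_0. lra.
Qed.

(** The fixed point of the step solves the integral equation, whose right-hand
    side is differentiable. *)
Lemma global_solution :
  exists g : R -> I -> R, (forall i, g 0 i = x0 i) /\
    forall t i, 0 <= t -> is_derive (fun s => g s i) t (f i (g t)).
Proof.
  exists (picard_step picard_limit). split.
  - intros i. unfold picard_step. rewrite (RInt_point (V := R_CompleteNormedModule)).
    apply Rplus_0_r.
  - intros t i Ht.
    replace (f i (picard_step picard_limit t)) with (0 + f i (picard_limit t)).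
    + unfold picard_step. apply (is_derive_plus (V := R_NormedModule)).
      * apply (is_derive_const (V := R_NormedModule)).
      * apply (is_derive_RInt (V := R_NormedModule) (fun s => f i (picard_limit s)) _ 0).
        -- apply filter_forall. intros b.
           apply (RInt_correct (V := R_CompleteNormedModule)).
           apply integrand_integrable, picard_limit_lipschitz.
        -- apply integrand_continuous, picard_limit_lipschitz.
    + rewrite Rplus_0_l. apply Rminus_diag_uniq, Rabs_eq_0.
      apply Rle_antisym; [|apply Rabs_pos].
      replace 0 with (K * 0) by ring. apply f_lipschitz. intros j.
      rewrite picard_limit_fixed, Rminus_diag, Rabs_R0 by trivial. lra.
Qed.

End Picard.

(** * Calculus along an orbit *)

Section ProductDerivative.
Context {U V : NormedModule R_AbsRing}.

Lemma is_derive_fst (g : R -> U * V) t l :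
  is_derive g t l -> is_derive (fun s => fst (g s)) t (fst l).
Proof.
  intros H.
  apply (filterdiff_comp' (U := R_NormedModule) (V := prod_NormedModule R_AbsRing U V)
           (W := U) g fst t (fun y => scal y l) fst H).
  apply filterdiff_linear, is_linear_fst.
Qed.

Lemma is_derive_snd (g : R -> U * V) t l :
  is_derive g t l -> is_derive (fun s => snd (g s)) t (snd l).
Proof.
  intros H.
  apply (filterdiff_comp' (U := R_NormedModule) (V := prod_NormedModule R_AbsRing U V)
           (W := V) g snd t (fun y => scal y l) snd H).
  apply filterdiff_linear, is_linear_snd.
Qed.

Lemma is_derive_pair (g1 : R -> U) (g2 : R -> V) t l1 l2 :
  is_derive g1 t l1 -> is_derive g2 t l2 ->
  is_derive (fun s => (g1 s, g2 s)) t (l1, l2).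
Proof.
  intros H1 H2.
  apply (filterdiff_comp'_2 (T := R_NormedModule) (U := U) (V := V)
    (W := prod_NormedModule R_AbsRing U V) g1 g2 (fun a b => (a, b)) t
    (fun y => scal y l1) (fun y => scal y l2) (fun a b => (a, b)) H1 H2).
  apply (filterdiff_ext_lin _ (fun t => t)).
  - apply filterdiff_ext with (fun t => t); [now intros []|apply filterdiff_id].
  - now intros [].
Qed.

End ProductDerivative.

Lemma is_derive_continuous (u : R -> R) t l : is_derive u t l -> continuous u t.
Proof.
  intros H. apply (ex_derive_continuous (V := R_NormedModule)). now exists l.
Qed.

Lemma derivative_nonneg_le (u du : R -> R) (s : R) :
  0 <= s -> (forall t, 0 <= t <= s -> is_derive u t (du t)) ->
  (forall t, 0 <= t <= s -> 0 <= du t) -> u 0 <= u s.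
Proof.
  intros Hs Hd Hp.
  destruct (MVT_gen u 0 s du) as (c & Hc & E).
  - intros t. rewrite Rmin_left, Rmax_right by trivial. intros Ht. apply Hd; lra.
  - intros t. rewrite Rmin_left, Rmax_right by trivial. intros Ht.
    apply continuity_pt_filterlim. eapply is_derive_continuous. now apply Hd.
  - rewrite Rmin_left, Rmax_right in Hc by trivial.
    assert (0 <= du c * (s - 0)) by (apply Rmult_le_pos; [now apply Hp|lra]).
    lra.
Qed.

Lemma gronwall_lower (u du : R -> R) (c s : R) :
  0 <= s -> (forall t, 0 <= t <= s -> is_derive u t (du t)) ->
  (forall t, 0 <= t <= s -> c * u t <= du t) -> u 0 * exp (c * s) <= u s.
Proof.
  intros Hs Hd Hc.
  assert (H : u 0 * exp (- c * 0) <= u s * exp (- c * s)).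
  { apply (derivative_nonneg_le (fun t => u t * exp (- c * t))
             (fun t => (du t - c * u t) * exp (- c * t))); trivial.
    - intros t Ht. specialize (Hd t Ht).
      evar_last; [apply (is_derive_mult (K := R_AbsRing)); [exact Hd| |apply Rmult_comm]|].
      + auto_derive; [trivial|reflexivity].
      + unfold plus, mult; simpl. ring.
    - intros t Ht. apply Rmult_le_pos; [|left; apply exp_pos].
      generalize (Hc t Ht); lra. }
  rewrite Rmult_0_r, exp_0, Rmult_1_r in H.
  apply Rmult_le_compat_r with (r := exp (c * s)) in H; [|left; apply exp_pos].
  rewrite Rmult_assoc, <- exp_plus in H.
  replace (- c * s + c * s) with 0 in H by ring. rewrite exp_0, Rmult_1_r in H.
  exact H.
Qed.

Lemma gronwall_upper (u du : R -> R) (c s : R) :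
  0 <= s -> (forall t, 0 <= t <= s -> is_derive u t (du t)) ->
  (forall t, 0 <= t <= s -> du t <= c * u t) -> u s <= u 0 * exp (c * s).
Proof.
  intros Hs Hd Hc.
  assert (H : - u 0 * exp (c * s) <= - u s).
  { apply (gronwall_lower (fun t => - u t) (fun t => - du t)); trivial.
    - intros t Ht. apply (is_derive_opp (V := R_NormedModule)). now apply Hd.
    - intros t Ht. generalize (Hc t Ht); lra. }
  lra.
Qed.

(** Compare [u] and [- u] with the primitive [- A / k * exp (- k * t)] of the
    bound on the derivative. *)
Lemma variation_le_exp (u du : R -> R) (A k s : R) :
  0 < k -> 0 <= s -> (forall t, 0 <= t <= s -> is_derive u t (du t)) ->
  (forall t, 0 <= t <= s -> Rabs (du t) <= A * exp (- k * t)) ->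
  Rabs (u s - u 0) <= A / k.
Proof.
  intros Hk Hs Hd HA.
  assert (HA0 : 0 <= A).
  { assert (H := HA 0 (conj (Rle_refl 0) Hs)).
    rewrite Rmult_0_r, exp_0, Rmult_1_r in H.
    eapply Rle_trans; [apply Rabs_pos|exact H]. }
  assert (G : forall e, e = 1 \/ e = - 1 -> e * (u s - u 0) <= A / k).
  { intros e He.
    assert (H : - A / k * exp (- k * 0) - e * u 0
                <= - A / k * exp (- k * s) - e * u s).
    { apply (derivative_nonneg_le (fun t => - A / k * exp (- k * t) - e * u t)
               (fun t => A * exp (- k * t) - e * du t)); trivial.
      - intros t Ht. apply (is_derive_minus (V := R_NormedModule)).
        + auto_derive; trivial. field. lra.
        + apply (is_derive_scal (fun t => u t)). now apply Hd.
      - intros t Ht. specialize (HA t Ht). apply Rabs_le_between in HA.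
        destruct He as [-> | ->]; lra. }
    rewrite Rmult_0_r, exp_0 in H.
    assert (0 <= A / k * exp (- k * s)).
    { apply Rmult_le_pos; [|left; apply exp_pos].
      apply Rmult_le_pos; [trivial|left; now apply Rinv_0_lt_compat]. }
    unfold Rdiv in *. lra. }
  apply Rabs_le_between.
  generalize (G 1 (or_introl eq_refl)) (G (- 1) (or_intror eq_refl)). lra.
Qed.

Lemma variation_le_linear (u du : R -> R) (A s : R) :
  0 <= s -> (forall t, 0 <= t <= s -> is_derive u t (du t)) ->
  (forall t, 0 <= t <= s -> Rabs (du t) <= A) ->
  Rabs (u s - u 0) <= A * s.
Proof.
  intros Hs Hd HA.
  destruct (MVT_gen u 0 s du) as (c & Hc & E).
  - intros t. rewrite Rmin_left, Rmax_right by trivial. intros Ht. apply Hd; lra.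
  - intros t. rewrite Rmin_left, Rmax_right by trivial. intros Ht.
    apply continuity_pt_filterlim. eapply is_derive_continuous. now apply Hd.
  - rewrite Rmin_left, Rmax_right in Hc by trivial.
    rewrite E, Rminus_0_r, Rabs_mult, (Rabs_pos_eq s) by trivial.
    apply Rmult_le_compat_r; auto.
Qed.

(** A bound that is open, is improved on every initial interval where its closed
    form holds, and passes to limits, holds throughout. *)
Lemma continuation (T : R) (weak strong : R -> Prop) :
  0 <= T -> strong 0 ->
  (forall s, 0 <= s <= T -> (forall t, 0 <= t <= s -> weak t) -> strong s) ->
  (forall s, 0 <= s <= T -> strong s -> locally s weak) ->
  (forall s, 0 < s <= T -> (forall t, 0 <= t < s -> weak t) -> weak s) ->
  forall s, 0 <= s <= T -> weak s.
Proof.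
  intros HT H0 Himp Hopen Hclosed.
  pose (E := fun s => 0 <= s <= T /\ forall t, 0 <= t <= s -> weak t).
  assert (E0 : E 0).
  { split; [lra|]. intros t Ht. replace t with 0 by lra.
    apply (locally_singleton 0 weak). apply Hopen; [lra|trivial]. }
  destruct (completeness E) as [tau [Hub Hlub]].
  { exists T. intros s [Hs _]. lra. }
  { now exists 0. }
  assert (Htau : 0 <= tau <= T).
  { split; [now apply Hub|]. apply Hlub. intros s [Hs _]. lra. }
  assert (Hbelow : forall t, 0 <= t < tau -> weak t).
  { intros t Ht. apply NNPP. intros Hn.
    assert (tau <= t); [|lra]. apply Hlub. intros s [Hs Hw].
    destruct (Rle_lt_dec s t) as [Hst|Hst]; trivial.
    elim Hn. apply Hw. lra. }
  assert (Etau : E tau).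
  { split; trivial. intros t Ht.
    destruct (Rle_lt_or_eq_dec t tau) as [Hl|Heq]; [lra|apply Hbelow; lra|].
    subst t. destruct (Rle_lt_or_eq_dec 0 tau) as [Hl|Heq]; [lra| |].
    - apply Hclosed; [lra|exact Hbelow].
    - rewrite <- Heq. apply E0. lra. }
  destruct Etau as [_ Hw].
  destruct (Hopen tau Htau (Himp tau Htau Hw)) as [eps Heps].
  assert (HtauT : tau = T).
  { destruct (Rle_lt_or_eq_dec tau T) as [Hl|Heq]; [lra| |trivial].
    exfalso. assert (Hpos := cond_pos eps).
    set (s := Rmin (tau + eps / 2) T).
    assert (Hs : tau < s <= tau + eps / 2 /\ s <= T).
    { unfold s. repeat split; [apply Rmin_glb_lt; lra|apply Rmin_l|apply Rmin_r]. }
    assert (s <= tau); [|lra]. apply Hub. split; [lra|].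
    intros t Ht. destruct (Rle_lt_dec t tau) as [Hl'|Hl']; [apply Hw; lra|].
    apply Heps. change (Rabs (t - tau) < eps). rewrite Rabs_pos_eq; lra. }
  intros s Hs. apply Hw. lra.
Qed.

Lemma locally_lt (u : R -> R) (c s : R) :
  continuous u s -> u s < c -> locally s (fun t => u t < c).
Proof. intros Hu H. exact (Hu _ (open_lt c (u s) H)). Qed.

Lemma locally_gt (u : R -> R) (c s : R) :
  continuous u s -> c < u s -> locally s (fun t => c < u t).
Proof. intros Hu H. exact (Hu _ (open_gt c (u s) H)). Qed.

Lemma left_limit_le (u : R -> R) (c s : R) :
  0 < s -> continuous u s -> (forall t, 0 <= t < s -> u t <= c) -> u s <= c.
Proof.
  intros Hs Hu H. destruct (Rle_lt_dec (u s) c) as [Hl|Hl]; trivial.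
  destruct (locally_gt u c s Hu Hl) as [eps Heps].
  assert (Hpos := cond_pos eps).
  set (t := Rmax 0 (s - eps / 2)).
  assert (Ht : 0 <= t < s /\ s - eps / 2 <= t).
  { unfold t. repeat split; [apply Rmax_l|apply Rmax_lub_lt; lra|apply Rmax_r]. }
  specialize (H t (proj1 Ht)).
  assert (c < u t); [|lra].
  apply Heps. change (Rabs (t - s) < eps). rewrite Rabs_minus_sym, Rabs_pos_eq; lra.
Qed.

Lemma left_limit_ge (u : R -> R) (c s : R) :
  0 < s -> continuous u s -> (forall t, 0 <= t < s -> c <= u t) -> c <= u s.
Proof.
  intros Hs Hu H. apply Ropp_le_cancel.
  apply (left_limit_le (fun t => - u t)); trivial.
  - apply (continuous_opp (V := R_NormedModule)), Hu.
  - intros t Ht. apply Ropp_le_contravar, H, Ht.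
Qed.

(** If the level were never reached for a first time, staying strictly below it
    would pass to limits, hence continue up to [T]. *)
Lemma first_hitting_time (u : R -> R) (T c : R) :
  (forall t, 0 <= t <= T -> continuous u t) -> 0 <= T ->
  u 0 < c -> c <= u T ->
  exists s, 0 < s <= T /\ u s = c /\ forall t, 0 <= t < s -> u t < c.
Proof.
  intros Hu HT H0 HcT. apply NNPP. intros Hn.
  assert (u T < c); [|lra].
  apply (continuation T (fun t => u t < c) (fun t => u t < c)); trivial; try lra.
  - intros s Hs H. apply H; lra.
  - intros s Hs H. apply locally_lt; auto.
  - intros s Hs H.
    destruct (left_limit_le u c s) as [Hl|He]; trivial; try lra.
    + apply Hu; lra.
    + intros t Ht. left. now apply H.
    + elim Hn. exists s. auto.
Qed.

(** * Uniform bounds near the center manifold *)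

Definition in_box (d : R) (x : R4) : Prop :=
  let '(v1, v2, r, _) := x in Rabs v1 <= d /\ Rabs v2 <= d /\ - d <= r <= 1 + d.

Definition bounded_lipschitz (d N : R) (f : R4 -> R) : Prop :=
  forall x y B, in_box d x -> in_box d y -> near4 B x y ->
    Rabs (f x) <= N /\ Rabs (f x - f y) <= N * B.

Lemma near4_nonneg B x y : near4 B x y -> 0 <= B.
Proof.
  destruct x as [[[? ?] ?] ?], y as [[[? ?] ?] ?]. intros [H _].
  eapply Rle_trans; [apply Rabs_pos|exact H].
Qed.

Lemma in_box_shrink d d' x : d <= d' -> in_box d x -> in_box d' x.
Proof. destruct x as [[[v1 v2] r] phi]. simpl. lra. Qed.

Lemma bounded_lipschitz_weaken d d' N N' f :
  d' <= d -> N <= N' -> bounded_lipschitz d N f -> bounded_lipschitz d' N' f.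
Proof.
  intros Hd HN H x y B Hx Hy HB.
  assert (HB0 := near4_nonneg B x y HB).
  destruct (H x y B) as [H1 H2]; eauto using in_box_shrink.
  split; [lra|]. eapply Rle_trans; [exact H2|]. apply Rmult_le_compat_r; lra.
Qed.

Lemma periodic_on_IZR delta f v1 v2 r phi (k : Z) :
  periodic_on delta f -> coord_domain delta (v1, v2, r, phi) ->
  f (v1, v2, r, phi + IZR k) = f (v1, v2, r, phi).
Proof.
  intros Hp Hd.
  assert (Hn : forall n psi, f (v1, v2, r, psi + INR n) = f (v1, v2, r, psi)).
  { induction n as [|n IH]; intros psi; [simpl; now rewrite Rplus_0_r|].
    rewrite S_INR, <- Rplus_assoc, Hp; [apply IH|exact Hd]. }
  destruct (Z_le_gt_dec 0 k) as [Hk|Hk].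
  - rewrite <- (Z2Nat.id k Hk), <- INR_IZR_INZ. apply Hn.
  - rewrite <- (Hn (Z.to_nat (- k)) (phi + IZR k)).
    rewrite INR_IZR_INZ, Z2Nat.id, opp_IZR by lia. do 2 f_equal. ring.
Qed.

Lemma unit_translate (phi : R) : exists k : Z, 0 <= phi + IZR k <= 1.
Proof.
  exists (- Int_part phi)%Z. rewrite opp_IZR.
  generalize (base_Int_part phi). lra.
Qed.

(** Compactness of the rectangle of [(r, phi)] gives uniform constants; the
    angle is unbounded, but a translation by a period brings it to [0, 1]. *)
Lemma periodic_bounded_lipschitz delta f :
  0 < delta -> periodic_on delta f ->
  (forall x, coord_domain delta x -> exists rho, 0 < rho /\ lipschitz_near4 f rho x) ->
  exists d N, 0 < d < delta /\ bounded_lipschitz d N f.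
Proof.
  intros Hdelta Hper Hloc.
  destruct (compact_uniform_size 2 (0, (0, tt)) (1, (1, tt))
    (fun rho x => let '(r, (phi, _)) := x in lipschitz_near4 f rho (0, 0, r, phi)))
    as (d1 & Hd1 & HL).
  - intros [r [phi []]] (Hr & Hphi & _).
    destruct (Hloc (0, 0, r, phi)) as (rho & Hrho & HL).
    { simpl. rewrite Rabs_R0. lra. }
    exists (rho / 2). split; [lra|].
    intros [r' [phi' []]] (Hr' & Hphi' & _).
    intros [[[y1 y2] y3] y4] [[[z1 z2] z3] z4] B (Y1 & Y2 & Y3 & Y4)
      (Z1 & Z2 & Z3 & Z4) HB.
    assert (Ht : forall a b c, Rabs (a - b) <= rho / 2 -> Rabs (b - c) < rho / 2 ->
              Rabs (a - c) <= rho).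
    { intros a b c H1 H2. replace (a - c) with ((a - b) + (b - c)) by ring.
      eapply Rle_trans; [apply Rabs_triang|lra]. }
    destruct (HL (y1, y2, y3, y4) (z1, z2, z3, z4) B) as [H1 H2]; trivial.
    1,2: repeat split; eauto; lra.
    assert (Hi : / rho <= / (rho / 2)) by (apply Rinv_le_contravar; lra).
    split; [lra|]. eapply Rle_trans; [exact H2|].
    apply Rmult_le_compat_l; [|exact Hi]. eapply near4_nonneg; exact HB.
  - intros rho rho' [r [phi []]] [Hrho' Hle] HL y z B Hy Hz HB.
    assert (Hn : forall x, near4 rho' x (0, 0, r, phi) -> near4 rho x (0, 0, r, phi)).
    { intros [[[x1 x2] x3] x4] (X1 & X2 & X3 & X4). repeat split; lra. }
    destruct (HL y z B) as [H1 H2]; auto.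
    assert (Hi : / rho <= / rho') by (apply Rinv_le_contravar; lra).
    split; [lra|]. eapply Rle_trans; [exact H2|].
    apply Rmult_le_compat_l; [|exact Hi]. eapply near4_nonneg; exact HB.
  - pose (d := Rmin d1 delta / 2).
    assert (Hm : 0 < Rmin d1 delta) by (now apply Rmin_pos).
    assert (Hm1 := Rmin_l d1 delta). assert (Hm2 := Rmin_r d1 delta).
    assert (Hd : 0 < d /\ d <= d1 / 2 /\ d < delta) by (unfold d; lra).
    destruct Hd as (Hd & Hdd1 & Hddelta).
    assert (Hi : 0 < / d1) by now apply Rinv_0_lt_compat.
    exists d, (/ d1 + 4 * (/ d1 * / d1)). split; [lra|].
    assert (Hii : 0 < / d1 * / d1) by now apply Rmult_lt_0_compat.
    (* A nearby pair has a common center in the rectangle, after translation. *)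
    assert (Hnear : forall x y B, in_box d x -> in_box d y -> near4 B x y ->
              B <= d1 / 2 ->
              Rabs (f x) <= / d1 /\ Rabs (f x - f y) <= B / d1).
    { intros [[[x1 x2] x3] x4] [[[y1 y2] y3] y4] B (X1 & X2 & X3)
        (Y1 & Y2 & Y3) (B1 & B2 & B3 & B4) HB.
      destruct (unit_translate x4) as [k Hk].
      rewrite <- (periodic_on_IZR delta f x1 x2 x3 x4 k Hper),
              <- (periodic_on_IZR delta f y1 y2 y3 y4 k Hper)
        by (simpl; lra).
      set (c := Rmax 0 (Rmin 1 x3)).
      assert (Hc : 0 <= c <= 1 /\ Rabs (x3 - c) <= d).
      { unfold c. split; [split; [apply Rmax_l|apply Rmax_lub; [lra|apply Rmin_l]]|].
        apply Rabs_le_between. unfold Rmax, Rmin.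
        destruct (Rle_dec 1 x3); destruct (Rle_dec 0 _); lra. }
      destruct Hc as [Hc Hxc].
      apply (HL (c, (x4 + IZR k, tt))); simpl; auto.
      - rewrite !Rminus_0_r, Rminus_diag, Rabs_R0. repeat split; lra.
      - rewrite !Rminus_0_r. repeat split; try lra.
        + replace (y3 - c) with ((x3 - c) - (x3 - y3)) by ring.
          eapply Rle_trans; [apply Rabs_triang|]. rewrite Rabs_Ropp. lra.
        + replace (y4 + IZR k - (x4 + IZR k)) with (- (x4 - y4)) by ring.
          rewrite Rabs_Ropp. lra.
      - repeat split; trivial.
        replace (x4 + IZR k - (y4 + IZR k)) with (x4 - y4) by ring. trivial. }
    assert (Hbound : forall x, in_box d x -> Rabs (f x) <= / d1).
    { intros x Hx. apply (Hnear x x 0); trivial; [|lra].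
      destruct x as [[[x1 x2] x3] x4]. simpl.
      rewrite !Rminus_diag, Rabs_R0. repeat split; lra. }
    intros x y B Hx Hy HB. assert (HB0 := near4_nonneg _ _ _ HB).
    split; [generalize (Hbound x Hx); lra|].
    assert (0 <= / d1 * / d1 * B) by (apply Rmult_le_pos; lra).
    assert (0 <= / d1 * B) by (apply Rmult_le_pos; lra).
    destruct (Rle_lt_dec B (d1 / 2)) as [Hs|Hs].
    + eapply Rle_trans; [apply (Hnear x y B); trivial|]. unfold Rdiv. lra.
    + eapply Rle_trans; [apply Rabs_triang|]. rewrite Rabs_Ropp.
      generalize (Hbound x Hx) (Hbound y Hy).
      assert (/ d1 <= 2 * (/ d1 * / d1 * B)).
      { apply Rmult_le_reg_l with d1; trivial.
        apply Rmult_le_reg_l with d1; trivial.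
        replace (d1 * (d1 * (2 * (/ d1 * / d1 * B)))) with (2 * B) by (field; lra).
        replace (d1 * (d1 * / d1)) with d1 by (field; lra). lra. }
      lra.
Qed.

Definition of_radius (u : R -> R) (x : R4) : R := let '(_, _, r, _) := x in u r.

Lemma radial_bounded_lipschitz delta u :
  0 < delta -> (forall r, - delta < r < 1 + delta -> analytic_at1 u r) ->
  exists d N, 0 < d < delta /\ bounded_lipschitz d N (of_radius u).
Proof.
  intros Hdelta Hu. apply periodic_bounded_lipschitz; trivial.
  - now intros v1 v2 r phi _.
  - intros [[[v1 v2] r] phi] (_ & _ & Hr).
    destruct (analytic_at1_lipschitz u r (Hu r Hr)) as (rho & Hrho & HL).
    exists rho. split; trivial.
    intros [[[y1 y2] y3] y4] [[[z1 z2] z3] z4] B (_ & _ & Y & _) (_ & _ & Z & _)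
      (_ & _ & HB & _).
    simpl. destruct (HL y3 z3 Y Z) as [H1 H2]. split; trivial.
    eapply Rle_trans; [exact H2|]. apply Rmult_le_compat_r; trivial.
    left; now apply Rinv_0_lt_compat.
Qed.

Lemma analytic_bounded_lipschitz delta f :
  0 < delta -> (forall x, coord_domain delta x -> analytic_at4 f x) ->
  periodic_on delta f ->
  exists d N, 0 < d < delta /\ bounded_lipschitz d N f.
Proof.
  intros Hdelta Hf Hp. apply periodic_bounded_lipschitz; trivial.
  intros x Hx. now apply analytic_at4_lipschitz, Hf.
Qed.

Record uniform_bounds (S : local_system) (d m N : R) : Prop := {
  p_lower : forall r, - d <= r <= 1 + d -> m <= p S r;
  vsigma_upper : forall r, - d <= r <= 1 + d -> vsigma S r <= - m;
  trace_upper : forall r, - d <= r <= 1 + d -> p S r + vsigma S r <= - m;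
  p_tame : bounded_lipschitz d N (of_radius (p S));
  vsigma_tame : bounded_lipschitz d N (of_radius (vsigma S));
  omega_tame : bounded_lipschitz d N (of_radius (omega S));
  p_0_tame : bounded_lipschitz d N (p_0 S);
  vsigma_0_tame : bounded_lipschitz d N (vsigma_0 S);
  r_0_tame : bounded_lipschitz d N (r_0 S);
  omega_0_tame : bounded_lipschitz d N (omega_0 S)
}.

Lemma of_radius_bound d N u r :
  0 < d -> bounded_lipschitz d N (of_radius u) -> - d <= r <= 1 + d ->
  Rabs (u r) <= N.
Proof.
  intros Hd H Hr. apply (H (0, 0, r, 0) (0, 0, r, 0) 0); simpl;
    rewrite ?Rminus_diag, Rabs_R0; lra.
Qed.

Lemma of_radius_lipschitz d N u r r' :
  0 < d -> bounded_lipschitz d N (of_radius u) ->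
  - d <= r <= 1 + d -> - d <= r' <= 1 + d ->
  Rabs (u r - u r') <= N * Rabs (r - r').
Proof.
  intros Hd H Hr Hr'.
  apply (H (0, 0, r, 0) (0, 0, r', 0) (Rabs (r - r'))); simpl;
    rewrite ?Rminus_diag, ?Rabs_R0; repeat split; try lra; apply Rabs_pos.
Qed.

Lemma exists_uniform_bounds S delta :
  0 < delta -> analytic_local_system S delta ->
  (forall r, 0 <= r <= 1 ->
     0 < p S r /\ vsigma S r < 0 /\ p S r + vsigma S r < 0) ->
  exists d m N, 0 < d < delta /\ d <= 1 /\ 0 < m /\ 0 < N /\
    uniform_bounds S d m N.
Proof.
  intros Hdelta HS Hsign. destruct HS.
  destruct (radial_bounded_lipschitz delta (p S)) as (d1 & N1 & D1 & L1); trivial.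
  destruct (radial_bounded_lipschitz delta (vsigma S)) as (d2 & N2 & D2 & L2); trivial.
  destruct (radial_bounded_lipschitz delta (omega S)) as (d3 & N3 & D3 & L3); trivial.
  destruct (analytic_bounded_lipschitz delta (p_0 S)) as (d4 & N4 & D4 & L4); trivial.
  destruct (analytic_bounded_lipschitz delta (vsigma_0 S)) as (d5 & N5 & D5 & L5); trivial.
  destruct (analytic_bounded_lipschitz delta (r_0 S)) as (d6 & N6 & D6 & L6); trivial.
  destruct (analytic_bounded_lipschitz delta (omega_0 S)) as (d7 & N7 & D7 & L7); trivial.
  assert (Hd : exists d, 0 < d <= 1 /\ d <= d1 /\ d <= d2 /\ d <= d3 /\ d <= d4 /\
                 d <= d5 /\ d <= d6 /\ d <= d7).
  { exists (Rmin 1 (Rmin d1 (Rmin d2 (Rmin d3 (Rmin d4 (Rmin d5 (Rmin d6 d7))))))).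
    split; [split; [repeat apply Rmin_pos; lra|apply Rmin_l]|].
    repeat split; repeat (apply Rmin_l || (eapply Rle_trans; [apply Rmin_r|])); lra. }
  assert (HN : exists N, 0 < N /\ N1 <= N /\ N2 <= N /\ N3 <= N /\ N4 <= N /\
                 N5 <= N /\ N6 <= N /\ N7 <= N).
  { exists (1 + Rabs N1 + Rabs N2 + Rabs N3 + Rabs N4 + Rabs N5 + Rabs N6 + Rabs N7).
    generalize (Rabs_pos N1) (Rabs_pos N2) (Rabs_pos N3) (Rabs_pos N4) (Rabs_pos N5)
      (Rabs_pos N6) (Rabs_pos N7) (Rle_abs N1) (Rle_abs N2) (Rle_abs N3)
      (Rle_abs N4) (Rle_abs N5) (Rle_abs N6) (Rle_abs N7).
    intros. repeat split; lra. }
  destruct Hd as (d & Hd & E1 & E2 & E3 & E4 & E5 & E6 & E7).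
  destruct HN as (N & HN & G1 & G2 & G3 & G4 & G5 & G6 & G7).
  apply (bounded_lipschitz_weaken d1 d N1 N) in L1; trivial.
  apply (bounded_lipschitz_weaken d2 d N2 N) in L2; trivial.
  destruct (compact_uniform_size 1 (0, tt) (1, tt)
    (fun rho x => let '(r, _) := x in forall z, Rabs (z - r) <= rho ->
       rho <= p S z /\ vsigma S z <= - rho /\ p S z + vsigma S z <= - rho))
    as (m & Hm & HQ).
  - intros [r []] [Hr _]. destruct (Hsign r Hr) as (P1 & P2 & P3).
    set (P := Rmin (p S r) (Rmin (- vsigma S r) (- (p S r + vsigma S r)))).
    assert (HP : 0 < P) by (repeat apply Rmin_pos; lra).
    assert (Q1 : P <= p S r) by apply Rmin_l.
    assert (Q2 : P <= - vsigma S r).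
    { eapply Rle_trans; [apply Rmin_r|apply Rmin_l]. }
    assert (Q3 : P <= - (p S r + vsigma S r)).
    { eapply Rle_trans; [apply Rmin_r|apply Rmin_r]. }
    set (rho := Rmin (d / 2) (P / (4 * N + 1))).
    assert (H4 : 0 < P / (4 * N + 1)) by (apply Rdiv_lt_0_compat; lra).
    assert (Hrho : 0 < rho) by (apply Rmin_pos; lra).
    assert (Hrd : rho <= d / 2) by apply Rmin_l.
    assert (HrP : rho * (4 * N + 1) <= P).
    { apply Rle_trans with (P / (4 * N + 1) * (4 * N + 1)).
      - apply Rmult_le_compat_r; [lra|apply Rmin_r].
      - right; field; lra. }
    exists rho. split; trivial. intros [y []] [Hy _] z Hz.
    assert (Hzr : Rabs (z - r) <= 2 * rho).
    { replace (z - r) with ((z - y) + (y - r)) by ring.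
      eapply Rle_trans; [apply Rabs_triang|lra]. }
    assert (Hzb := proj1 (Rabs_le_between _ _) Hzr).
    assert (HNr : N * Rabs (z - r) <= N * (2 * rho)) by (apply Rmult_le_compat_l; lra).
    assert (Hp := of_radius_lipschitz d N (p S) z r (proj1 Hd) L1 ltac:(lra) ltac:(lra)).
    assert (Hv := of_radius_lipschitz d N (vsigma S) z r (proj1 Hd) L2 ltac:(lra) ltac:(lra)).
    assert (Hp' := proj1 (Rabs_le_between _ _) (Rle_trans _ _ _ Hp HNr)).
    assert (Hv' := proj1 (Rabs_le_between _ _) (Rle_trans _ _ _ Hv HNr)).
    lra.
  - intros rho rho' [r []] Hrho HQ z Hz.
    destruct (HQ z ltac:(lra)) as (Z1 & Z2 & Z3). lra.
  - set (d' := Rmin d m).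
    assert (Hd' : 0 < d' /\ d' <= d /\ d' <= m).
    { repeat split; [apply Rmin_pos; lra|apply Rmin_l|apply Rmin_r]. }
    assert (Hsigns : forall r, - d' <= r <= 1 + d' ->
        m <= p S r /\ vsigma S r <= - m /\ p S r + vsigma S r <= - m).
    { intros r Hr. set (c := Rmax 0 (Rmin 1 r)).
      assert (Hc : 0 <= c <= 1 /\ Rabs (r - c) <= m).
      { unfold c. split; [split; [apply Rmax_l|apply Rmax_lub; [lra|apply Rmin_l]]|].
        apply Rabs_le_between. unfold Rmax, Rmin.
        destruct (Rle_dec 1 r); destruct (Rle_dec 0 _); lra. }
      apply (HQ (c, tt)); [split; [|exact Logic.I]|]; apply Hc. }
    exists d', m, N. split; [lra|]. split; [lra|]. split; [lra|]. split; [lra|].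
    split; try (intros r Hr; now apply Hsigns);
      match goal with
      | _ : bounded_lipschitz ?d0 ?N0 ?f |- bounded_lipschitz _ _ ?f =>
          apply (bounded_lipschitz_weaken d0 d' N0 N); trivial; lra
      end.
Qed.

(** * Passage near the center manifold *)

Definition local_equations (S : local_system) (v1 v2 r phi : R -> R) (t : R) : Prop :=
  let x := (v1 t, v2 t, r t, phi t) in
  is_derive v1 t (p S (r t) * v1 t + p_0 S x * v1 t ^ 2 * v2 t) /\
  is_derive v2 t (vsigma S (r t) * v2 t + vsigma_0 S x * v1 t * v2 t ^ 2) /\
  is_derive r t (v1 t * v2 t * r_0 S x) /\
  is_derive phi t (omega S (r t) + v1 t * v2 t * omega_0 S x).

Section Passage.

Variables (S : local_system) (d m N h xi r1 : R).
Hypothesis bounds : uniform_bounds S d m N.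
Hypotheses (d_pos : 0 < d) (d_le_1 : d <= 1) (m_pos : 0 < m) (N_pos : 0 < N).
(** Under the second condition the linear rates dominate the coupling terms and
    the radius drifts by less than [d / 2]. *)
Hypotheses (h_lt_d : h < d) (h_small : 4 * N * h <= m * d).
Hypotheses (xi_pos : 0 < xi) (xi_le_h : xi <= h).
Hypothesis r1_range : - d / 2 <= r1 <= 1 + d / 2.

Variables (v1 v2 r phi : R -> R) (T : R).
Hypothesis T_nonneg : 0 <= T.
Hypotheses (v1_start : v1 0 = xi) (v2_start : v2 0 = h) (r_start : r 0 = r1).
Hypothesis orbit_continuous : forall t, 0 <= t <= T ->
  continuous v1 t /\ continuous v2 t /\ continuous r t.
(** The equations are only required where the orbit is in the box, so that the
    estimates also apply to a field modified outside of it. *)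
Hypothesis orbit_equations : forall t, 0 <= t <= T ->
  in_box d (v1 t, v2 t, r t, phi t) -> local_equations S v1 v2 r phi t.
Hypothesis v1_below : forall t, 0 <= t <= T -> v1 t <= h.

Let x t : R4 := (v1 t, v2 t, r t, phi t).

Let weak t := (0 <= v1 t <= d /\ 0 <= v2 t <= d) /\ - d <= r t <= 1 + d.
Let strong t := (0 < v1 t < d /\ 0 < v2 t < d) /\ - d < r t < 1 + d.

Lemma weak_in_box t : weak t -> in_box d (x t).
Proof.
  intros ((H1 & H2) & H3). simpl. rewrite !Rabs_pos_eq by lra. lra.
Qed.

Lemma tame_bound f t : bounded_lipschitz d N f -> weak t -> Rabs (f (x t)) <= N.
Proof.
  intros Hf Hw. apply weak_in_box in Hw.
  apply (Hf (x t) (x t) 0); trivial. simpl. rewrite !Rminus_diag, Rabs_R0. lra.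
Qed.

Lemma product_range t : 0 <= t <= T -> weak t -> 0 <= v1 t * v2 t <= h * d.
Proof.
  intros Ht ((H1 & H2) & _). assert (H := v1_below t Ht). split.
  - apply Rmult_le_pos; lra.
  - apply Rmult_le_compat; lra.
Qed.

(** The product of [v1] and [v2] is at most [h * d], so the coupling terms change
    the linear rates by at most a quarter of the hyperbolicity constant [m]. *)
Lemma perturbation_small f t :
  bounded_lipschitz d N f -> 0 <= t <= T -> weak t ->
  - (m / 4) <= f (x t) * (v1 t * v2 t) <= m / 4.
Proof.
  intros Hf Ht Hw. apply Rabs_le_between. rewrite Rabs_mult.
  assert (Hq := product_range t Ht Hw). rewrite (Rabs_pos_eq (v1 t * v2 t)) by lra.
  apply Rle_trans with (N * (h * d)).
  - apply Rmult_le_compat; try lra; [apply Rabs_pos|now apply tame_bound].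
  - assert (4 * N * h * d <= m * d * d) by (apply Rmult_le_compat_r; lra).
    assert (m * d * d <= m * 1 * 1) by (repeat apply Rmult_le_compat; nra). lra.
Qed.

Lemma v1_grows s :
  0 <= s <= T -> (forall t, 0 <= t <= s -> weak t) ->
  xi * exp (m / 2 * s) <= v1 s.
Proof.
  intros Hs Hw. rewrite <- v1_start.
  eapply gronwall_lower; [lra| |].
  - intros t Ht.
    destruct (orbit_equations t ltac:(lra) (weak_in_box t (Hw t Ht)))
      as (H1 & H2 & H3 & H4). exact H1.
  - intros t Ht. simpl. specialize (Hw t Ht).
    assert (HP := perturbation_small (p_0 S) t (p_0_tame _ _ _ _ bounds) ltac:(lra) Hw).
    assert (Hp := p_lower _ _ _ _ bounds (r t) (proj2 Hw)).
    destruct Hw as ((H1 & _) & _).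
    apply Rle_trans with ((p S (r t) + p_0 S (x t) * (v1 t * v2 t)) * v1 t).
    + apply Rmult_le_compat_r; lra.
    + right; unfold x; ring.
Qed.

Lemma v2_positive s :
  0 <= s <= T -> (forall t, 0 <= t <= s -> weak t) -> 0 < v2 s.
Proof.
  intros Hs Hw.
  apply Rlt_le_trans with (v2 0 * exp ((- N - m / 4) * s)).
  { rewrite v2_start. apply Rmult_lt_0_compat; [lra|apply exp_pos]. }
  eapply gronwall_lower; [lra| |].
  - intros t Ht.
    destruct (orbit_equations t ltac:(lra) (weak_in_box t (Hw t Ht)))
      as (H1 & H2 & H3 & H4). exact H2.
  - intros t Ht. simpl. specialize (Hw t Ht).
    assert (HP := perturbation_small (vsigma_0 S) t (vsigma_0_tame _ _ _ _ bounds) ltac:(lra) Hw).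
    assert (Hv := of_radius_bound d N (vsigma S) (r t) d_pos
                    (vsigma_tame _ _ _ _ bounds) (proj2 Hw)).
    apply Rabs_le_between in Hv.
    destruct Hw as ((_ & H2) & _).
    apply Rle_trans with ((vsigma S (r t) + vsigma_0 S (x t) * (v1 t * v2 t)) * v2 t).
    + apply Rmult_le_compat_r; lra.
    + right; unfold x; ring.
Qed.

Lemma v2_decreases s :
  0 <= s <= T -> (forall t, 0 <= t <= s -> weak t) -> v2 s <= h.
Proof.
  intros Hs Hw.
  apply Rle_trans with (v2 0 * exp (0 * s)).
  2:{ rewrite v2_start, Rmult_0_l, exp_0. lra. }
  eapply gronwall_upper; [lra| |].
  - intros t Ht.
    destruct (orbit_equations t ltac:(lra) (weak_in_box t (Hw t Ht)))
      as (H1 & H2 & H3 & H4). exact H2.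
  - intros t Ht. simpl. specialize (Hw t Ht).
    assert (HP := perturbation_small (vsigma_0 S) t (vsigma_0_tame _ _ _ _ bounds) ltac:(lra) Hw).
    assert (Hv := vsigma_upper _ _ _ _ bounds (r t) (proj2 Hw)).
    destruct Hw as ((_ & H2) & _).
    apply Rle_trans with ((vsigma S (r t) + vsigma_0 S (x t) * (v1 t * v2 t)) * v2 t).
    + right; unfold x; ring.
    + apply Rmult_le_compat_r; lra.
Qed.

(** The condition that the saddle contracts, [p + vsigma < 0], makes the product
    of the hyperbolic coordinates decay; it is the size of every coupling term. *)
Lemma product_decays s :
  0 <= s <= T -> (forall t, 0 <= t <= s -> weak t) ->
  v1 s * v2 s <= xi * h * exp (- (m / 2) * s).
Proof.
  intros Hs Hw. rewrite <- v1_start, <- v2_start.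
  apply (gronwall_upper (fun t => v1 t * v2 t)
    (fun t => (p S (r t) * v1 t + p_0 S (x t) * v1 t ^ 2 * v2 t) * v2 t +
       v1 t * (vsigma S (r t) * v2 t + vsigma_0 S (x t) * v1 t * v2 t ^ 2))); [lra| |].
  - intros t Ht.
    assert (He := orbit_equations t ltac:(lra) (weak_in_box t (Hw t Ht))).
    apply (is_derive_mult (K := R_AbsRing) v1 v2); [apply He|apply He|apply Rmult_comm].
  - intros t Ht. simpl. specialize (Hw t Ht).
    assert (HP := perturbation_small (p_0 S) t (p_0_tame _ _ _ _ bounds) ltac:(lra) Hw).
    assert (HV := perturbation_small (vsigma_0 S) t (vsigma_0_tame _ _ _ _ bounds) ltac:(lra) Hw).
    assert (Ht' := trace_upper _ _ _ _ bounds (r t) (proj2 Hw)).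
    assert (Hq := product_range t ltac:(lra) Hw).
    apply Rle_trans with ((p S (r t) + vsigma S (r t) +
      p_0 S (x t) * (v1 t * v2 t) + vsigma_0 S (x t) * (v1 t * v2 t)) * (v1 t * v2 t)).
    + right; ring.
    + apply Rmult_le_compat_r; lra.
Qed.

(** The speed of [r] decays exponentially, hence the total drift is bounded
    independently of the time of passage, which tends to infinity as [xi]
    tends to 0. *)
Lemma radius_drift s :
  0 <= s <= T -> (forall t, 0 <= t <= s -> weak t) -> Rabs (r s - r1) <= xi * d / 2.
Proof.
  intros Hs Hw. rewrite <- r_start.
  apply Rle_trans with (N * (xi * h) / (m / 2)).
  - eapply variation_le_exp; [lra|lra| |].
    + intros t Ht.
      destruct (orbit_equations t ltac:(lra) (weak_in_box t (Hw t Ht)))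
        as (H1 & H2 & H3 & H4). exact H3.
    + intros t Ht. simpl.
      assert (HD := product_decays t ltac:(lra)
                      (fun u Hu => Hw u ltac:(lra))).
      specialize (Hw t Ht).
      assert (HN := tame_bound _ t (r_0_tame _ _ _ _ bounds) Hw).
      assert (Hq := product_range t ltac:(lra) Hw).
      rewrite Rabs_mult, (Rabs_pos_eq (v1 t * v2 t)) by lra.
      replace (N * (xi * h) * exp (- (m / 2) * t))
        with (xi * h * exp (- (m / 2) * t) * N) by ring.
      apply Rmult_le_compat; try lra; [apply Rabs_pos|exact HN].
  - apply Rmult_le_reg_r with (2 * m); [lra|].
    replace (N * (xi * h) / (m / 2) * (2 * m)) with (xi * (4 * N * h)) by (field; lra).
    replace (xi * d / 2 * (2 * m)) with (xi * (m * d)) by field.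
    apply Rmult_le_compat_l; lra.
Qed.

(** The estimates above improve the closed conditions that they assume, so these
    continue along the whole orbit. *)
Lemma orbit_stays_weak t : 0 <= t <= T -> weak t.
Proof.
  apply (continuation T weak strong); trivial.
  - unfold strong. rewrite v1_start, v2_start, r_start. lra.
  - intros s Hs Hw.
    assert (H1 := v1_grows s Hs Hw). assert (H2 := v2_positive s Hs Hw).
    assert (H3 := v2_decreases s Hs Hw). assert (H4 := radius_drift s Hs Hw).
    assert (H5 := v1_below s Hs).
    assert (H6 : 0 < xi * exp (m / 2 * s)).
    { apply Rmult_lt_0_compat; [trivial|apply exp_pos]. }
    assert (H7 : xi * d <= h * d) by (apply Rmult_le_compat_r; lra).
    assert (H8 : h * d < d) by nra.
    apply Rabs_le_between in H4.
    unfold strong. lra.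
  - intros s Hs Hst.
    destruct (orbit_continuous s Hs) as (C1 & C2 & C3).
    destruct Hst as (((A1 & A2) & A3 & A4) & A5 & A6).
    repeat apply filter_and.
    1: apply (filter_imp _ _ (fun t => Rlt_le 0 (v1 t)) (locally_gt _ _ _ C1 A1)).
    1: apply (filter_imp _ _ (fun t => Rlt_le (v1 t) d) (locally_lt _ _ _ C1 A2)).
    1: apply (filter_imp _ _ (fun t => Rlt_le 0 (v2 t)) (locally_gt _ _ _ C2 A3)).
    1: apply (filter_imp _ _ (fun t => Rlt_le (v2 t) d) (locally_lt _ _ _ C2 A4)).
    1: apply (filter_imp _ _ (fun t => Rlt_le (- d) (r t)) (locally_gt _ _ _ C3 A5)).
    apply (filter_imp _ _ (fun t => Rlt_le (r t) (1 + d)) (locally_lt _ _ _ C3 A6)).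
  - intros s Hs Hw.
    destruct (orbit_continuous s) as (C1 & C2 & C3); [lra|].
    assert (Hw' : forall t, 0 <= t < s -> weak t) by exact Hw. unfold weak in Hw'.
    repeat split.
    1: apply left_limit_ge; trivial; try lra; intros; apply Hw'; trivial.
    1: apply left_limit_le; trivial; try lra; intros; apply Hw'; trivial.
    1: apply left_limit_ge; trivial; try lra; intros; apply Hw'; trivial.
    1: apply left_limit_le; trivial; try lra; intros; apply Hw'; trivial.
    1: apply left_limit_ge; trivial; try lra; intros; apply Hw'; trivial.
    apply left_limit_le; trivial; try lra; intros; apply Hw'; trivial.
Qed.

Let initially_weak s (Hs : 0 <= s <= T) :
  forall t, 0 <= t <= s -> weak t := fun t Ht =>
  orbit_stays_weak t (conj (proj1 Ht) (Rle_trans _ _ _ (proj2 Ht) (proj2 Hs))).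

Lemma orbit_in_box t : 0 <= t <= T -> in_box d (x t).
Proof. intros Ht. now apply weak_in_box, orbit_stays_weak. Qed.

Lemma orbit_grows t : 0 <= t <= T -> xi * exp (m / 2 * t) <= v1 t.
Proof. intros Ht. apply v1_grows; trivial. now apply initially_weak. Qed.

Lemma v1_positive t : 0 <= t <= T -> 0 < v1 t.
Proof.
  intros Ht. eapply Rlt_le_trans; [|now apply orbit_grows].
  apply Rmult_lt_0_compat; [trivial|apply exp_pos].
Qed.

Lemma orbit_radius t : 0 <= t <= T -> Rabs (r t - r1) <= xi.
Proof.
  intros Ht. eapply Rle_trans; [now apply radius_drift, initially_weak|].
  nra.
Qed.

Lemma orbit_product t : 0 <= t <= T -> 0 <= v1 t * v2 t <= xi * h.
Proof.
  intros Ht. split; [apply product_range; trivial; now apply orbit_stays_weak|].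
  eapply Rle_trans; [now apply product_decays, initially_weak|].
  rewrite <- (Rmult_1_r (xi * h)) at 2.
  apply Rmult_le_compat_l; [apply Rmult_le_pos; lra|].
  rewrite <- exp_0. destruct (Rle_lt_or_eq_dec (- (m / 2) * t) 0) as [Hl|He].
  - nra.
  - left; now apply exp_increasing.
  - rewrite He. lra.
Qed.

Section Estimates.

Variable b : R.
Hypothesis b_range : 0 <= b <= 1.

(** Along the orbit the coefficients differ from their values at the radius [b]
    by at most this much. *)
Let E := N * (Rabs (r1 - b) + 2 * xi).

Lemma coefficient_drift u f t :
  bounded_lipschitz d N (of_radius u) -> bounded_lipschitz d N f -> 0 <= t <= T ->
  Rabs (u (r t) + f (x t) * (v1 t * v2 t) - u b) <= E.
Proof.
  intros Hu Hf Ht.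
  assert (Hw := orbit_stays_weak t Ht).
  assert (HL := of_radius_lipschitz d N u (r t) b d_pos Hu (proj2 Hw) ltac:(lra)).
  assert (HF := tame_bound f t Hf Hw).
  assert (HR := orbit_radius t Ht). assert (HQ := orbit_product t Ht).
  assert (Hxh : xi * h <= xi) by nra.
  assert (HB : Rabs (f (x t) * (v1 t * v2 t)) <= N * xi).
  { rewrite Rabs_mult, (Rabs_pos_eq (v1 t * v2 t)) by lra.
    apply Rmult_le_compat; try lra. apply Rabs_pos. }
  assert (HT : Rabs (r t - b) <= xi + Rabs (r1 - b)).
  { replace (r t - b) with ((r t - r1) + (r1 - b)) by ring.
    eapply Rle_trans; [apply Rabs_triang|lra]. }
  apply Rmult_le_compat_l with (r := N) in HT; [|lra].
  replace (u (r t) + f (x t) * (v1 t * v2 t) - u b)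
    with ((u (r t) - u b) + f (x t) * (v1 t * v2 t)) by ring.
  eapply Rle_trans; [apply Rabs_triang|]. unfold E. lra.
Qed.

Lemma logarithm_growth : Rabs (ln (v1 T) - ln xi - p S b * T) <= E * T.
Proof.
  replace (ln (v1 T) - ln xi - p S b * T)
    with ((ln (v1 T) - p S b * T) - (ln (v1 0) - p S b * 0))
    by (rewrite v1_start; ring).
  apply (variation_le_linear (fun t => ln (v1 t) - p S b * t)
     (fun t => p S (r t) + p_0 S (x t) * (v1 t * v2 t) - p S b)); trivial.
  - intros t Ht.
    assert (Hv := v1_positive t Ht).
    destruct (orbit_equations t Ht (orbit_in_box t Ht)) as (H1 & _).
    apply (is_derive_minus (V := R_NormedModule)).
    + evar_last; [apply (is_derive_comp (V := R_NormedModule) ln v1);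
                    [now apply is_derive_ln|exact H1]|].
      unfold scal; simpl; unfold mult; simpl. unfold x. field. lra.
    + auto_derive; trivial. ring.
  - intros t Ht. apply coefficient_drift; trivial; apply bounds.
Qed.

Lemma phase_growth : Rabs (phi T - phi 0 - omega S b * T) <= E * T.
Proof.
  replace (phi T - phi 0 - omega S b * T)
    with ((phi T - omega S b * T) - (phi 0 - omega S b * 0)) by ring.
  apply (variation_le_linear (fun t => phi t - omega S b * t)
     (fun t => omega S (r t) + omega_0 S (x t) * (v1 t * v2 t) - omega S b)); trivial.
  - intros t Ht.
    destruct (orbit_equations t Ht (orbit_in_box t Ht)) as (_ & _ & _ & H4).
    apply (is_derive_minus (V := R_NormedModule)).
    + evar_last; [exact H4|]. unfold x. ring.
    + auto_derive; trivial. ring.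
  - intros t Ht. apply coefficient_drift; trivial; apply bounds.
Qed.

Lemma passage_time : m / 2 * T <= ln h - ln xi.
Proof.
  assert (H := orbit_grows T ltac:(lra)). assert (HT := v1_below T ltac:(lra)).
  assert (H0 : 0 < xi * exp (m / 2 * T))
    by (apply Rmult_lt_0_compat; [trivial|apply exp_pos]).
  assert (Hl : ln (xi * exp (m / 2 * T)) <= ln h).
  { destruct (Rle_lt_or_eq_dec _ _ (Rle_trans _ _ _ H HT)) as [Hlt|Heq].
    - left. now apply ln_increasing.
    - rewrite Heq. lra. }
  rewrite ln_mult, ln_exp in Hl; trivial; [lra|apply exp_pos].
Qed.

(** The time of passage is eliminated between the growth of [ln v1] and that of
    the phase. *)
Lemma phase_of_arrival :
  v1 T = h ->
  Rabs (phi T - phi 0 - omega S b / p S b * (ln h - ln xi))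
    <= (1 + N / m) * E * (2 / m) * (ln h - ln xi).
Proof.
  intros HTh.
  assert (H1 := logarithm_growth). assert (H2 := phase_growth).
  assert (H3 := passage_time). rewrite HTh in H1.
  assert (Hp := p_lower _ _ _ _ bounds b ltac:(lra)).
  assert (Ho := of_radius_bound d N (omega S) b d_pos (omega_tame _ _ _ _ bounds)
                  ltac:(lra)).
  assert (HE : 0 <= E).
  { unfold E. apply Rmult_le_pos; [lra|]. generalize (Rabs_pos (r1 - b)); lra. }
  assert (HT : T <= 2 / m * (ln h - ln xi)).
  { apply Rmult_le_reg_l with (m / 2); [lra|].
    replace (m / 2 * (2 / m * (ln h - ln xi))) with (ln h - ln xi) by (field; lra).
    exact H3. }
  assert (Hq : Rabs (omega S b / p S b) <= N / m).
  { unfold Rdiv. rewrite Rabs_mult, Rabs_inv, (Rabs_pos_eq (p S b)) by lra.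
    apply Rmult_le_compat; [apply Rabs_pos| |trivial|].
    - left; apply Rinv_0_lt_compat; lra.
    - apply Rinv_le_contravar; lra. }
  replace (phi T - phi 0 - omega S b / p S b * (ln h - ln xi))
    with ((phi T - phi 0 - omega S b * T)
          - omega S b / p S b * (ln h - ln xi - p S b * T)) by (field; lra).
  eapply Rle_trans; [apply Rabs_triang|]. rewrite Rabs_Ropp, Rabs_mult.
  apply Rle_trans with (E * T + N / m * (E * T)).
  - apply Rplus_le_compat; trivial.
    apply Rmult_le_compat; trivial; apply Rabs_pos.
  - replace (E * T + N / m * (E * T)) with ((1 + N / m) * E * T) by ring.
    rewrite (Rmult_assoc ((1 + N / m) * E)).
    apply Rmult_le_compat_l; trivial.
    assert (0 < N / m) by now apply Rdiv_lt_0_compat.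
    apply Rmult_le_pos; lra.
Qed.

End Estimates.

End Passage.

Lemma is_derive_coordinates (g : R -> R4) t l1 l2 l3 l4 :
  is_derive g t ((l1, l2, l3, l4) : R4) ->
  is_derive (fun s => fst (fst (fst (g s)))) t l1 /\
  is_derive (fun s => snd (fst (fst (g s)))) t l2 /\
  is_derive (fun s => snd (fst (g s))) t l3 /\
  is_derive (fun s => snd (g s)) t l4.
Proof.
  intros H.
  assert (H3 := is_derive_fst (U := prod_NormedModule R_AbsRing
    (prod_NormedModule R_AbsRing R_NormedModule R_NormedModule) R_NormedModule)
    (V := R_NormedModule) g t _ H).
  assert (H2 := is_derive_fst (U := prod_NormedModule R_AbsRing R_NormedModule R_NormedModule)
    (V := R_NormedModule) _ t _ H3).
  refine (conj _ (conj _ (conj _ _))).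
  - exact (is_derive_fst (U := R_NormedModule) (V := R_NormedModule) _ t _ H2).
  - exact (is_derive_snd (U := R_NormedModule) (V := R_NormedModule) _ t _ H2).
  - exact (is_derive_snd (U := prod_NormedModule R_AbsRing R_NormedModule R_NormedModule)
             (V := R_NormedModule) _ t _ H3).
  - exact (is_derive_snd (U := prod_NormedModule R_AbsRing
      (prod_NormedModule R_AbsRing R_NormedModule R_NormedModule) R_NormedModule)
      (V := R_NormedModule) g t _ H).
Qed.

Lemma local_map_estimates S delta d m N h xi r1 phi1 v2' r' phi' b :
  uniform_bounds S d m N ->
  0 < d -> d <= 1 -> 0 < m -> 0 < N -> h < d -> 4 * N * h <= m * d ->
  0 < xi -> xi <= h -> - d / 2 <= r1 <= 1 + d / 2 -> 0 <= b <= 1 ->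
  local_map S delta h (xi, r1, phi1) (v2', r', phi') ->
  0 <= v2' <= xi /\ Rabs (r' - r1) <= xi /\
  Rabs (phi' - phi1 - omega S b / p S b * (ln h - ln xi))
    <= (1 + N / m) * (N * (Rabs (r1 - b) + 2 * xi)) * (2 / m) * (ln h - ln xi).
Proof.
  intros UB Hd Hd1 Hm HN Hhd Hh Hxi Hxih Hr1 Hb (g & T & HT & Hg0 & HgT & Hg & Hbelow).
  pose (v1 := fun t => fst (fst (fst (g t)))). pose (v2 := fun t => snd (fst (fst (g t)))).
  pose (r := fun t => snd (fst (g t))). pose (phi := fun t => snd (g t)).
  assert (Heq : forall t, g t = (v1 t, v2 t, r t, phi t)).
  { intros t. unfold v1, v2, r, phi. now destruct (g t) as [[[? ?] ?] ?]. }
  assert (S1 : v1 0 = xi) by (unfold v1; now rewrite Hg0).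
  assert (S2 : v2 0 = h) by (unfold v2; now rewrite Hg0).
  assert (S3 : r 0 = r1) by (unfold r; now rewrite Hg0).
  assert (S4 : phi 0 = phi1) by (unfold phi; now rewrite Hg0).
  assert (E1 : v1 T = h) by (unfold v1; now rewrite HgT).
  assert (E2 : v2 T = v2') by (unfold v2; now rewrite HgT).
  assert (E3 : r T = r') by (unfold r; now rewrite HgT).
  assert (E4 : phi T = phi') by (unfold phi; now rewrite HgT).
  assert (Heqs : forall t, 0 <= t <= T ->
            local_equations S v1 v2 r phi t).
  { intros t Ht. destruct (Hg t Ht) as [_ H]. rewrite Heq in H.
    exact (is_derive_coordinates g t _ _ _ _ H). }
  assert (Hc : forall t, 0 <= t <= T ->
            continuous v1 t /\ continuous v2 t /\ continuous r t).
  { intros t Ht. destruct (Heqs t Ht) as (H1 & H2 & H3 & _).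
    repeat split; eapply is_derive_continuous; eassumption. }
  assert (Hle : forall t, 0 <= t <= T -> v1 t <= h).
  { intros t Ht. destruct (Rle_lt_or_eq_dec t T) as [Hl|He]; [lra| |].
    - specialize (Hbelow t (conj (proj1 Ht) Hl)). rewrite Heq in Hbelow. lra.
    - subst t. lra. }
  assert (Heqs' : forall t, 0 <= t <= T ->
            in_box d (v1 t, v2 t, r t, phi t) -> local_equations S v1 v2 r phi t)
    by (intros t Ht _; exact (Heqs t Ht)).
  assert (HT' : 0 <= T <= T) by lra.
  rewrite <- E2, <- E3, <- E4, <- S4.
  repeat split.
  - assert (H := orbit_product S d m N h xi r1 UB Hd Hd1 Hm HN Hhd Hh Hxi Hxih Hr1
      v1 v2 r phi T ltac:(lra) S1 S2 S3 Hc Heqs' Hle T HT').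
    rewrite E1 in H. apply Rmult_le_reg_l with h; lra.
  - assert (H := orbit_product S d m N h xi r1 UB Hd Hd1 Hm HN Hhd Hh Hxi Hxih Hr1
      v1 v2 r phi T ltac:(lra) S1 S2 S3 Hc Heqs' Hle T HT').
    rewrite E1 in H. apply Rmult_le_reg_l with h; lra.
  - exact (orbit_radius S d m N h xi r1 UB Hd Hd1 Hm HN Hhd Hh Hxi Hxih Hr1
      v1 v2 r phi T ltac:(lra) S1 S2 S3 Hc Heqs' Hle T HT').
  - exact (phase_of_arrival S d m N h xi r1 UB Hd Hd1 Hm HN Hhd Hh Hxi Hxih Hr1
      v1 v2 r phi T ltac:(lra) S1 S2 S3 Hc Heqs' Hle b Hb E1).
Qed.

(** * Existence of the passage *)

Section Tame.

Variable d : R.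

Definition tame (f : R4 -> R) : Prop := exists N, bounded_lipschitz d N f.

Lemma tame_ext f g : (forall x, f x = g x) -> tame f -> tame g.
Proof.
  intros E [N H]. exists N. intros x y B Hx Hy HB. rewrite <- !E. now apply H.
Qed.

Lemma tame_plus f g : tame f -> tame g -> tame (fun x => f x + g x).
Proof.
  intros [N HN] [M HM]. exists (N + M). intros x y B Hx Hy HB.
  destruct (HN x y B Hx Hy HB) as [F1 F2]. destruct (HM x y B Hx Hy HB) as [G1 G2].
  split; [eapply Rle_trans; [apply Rabs_triang|lra]|].
  replace (f x + g x - (f y + g y)) with ((f x - f y) + (g x - g y)) by ring.
  eapply Rle_trans; [apply Rabs_triang|lra].
Qed.

Lemma near4_refl x : near4 0 x x.
Proof.
  destruct x as [[[? ?] ?] ?]. simpl. rewrite !Rminus_diag, Rabs_R0. lra.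
Qed.

Lemma tame_mult f g : tame f -> tame g -> tame (fun x => f x * g x).
Proof.
  intros [N HN] [M HM]. exists (2 * (N * M)). intros x y B Hx Hy HB.
  destruct (HN x y B Hx Hy HB) as [F1 F2]. destruct (HM x y B Hx Hy HB) as [G1 G2].
  destruct (HN y y 0 Hy Hy (near4_refl y)) as [F3 _].
  assert (HF := Rabs_pos (f x)). assert (HG := Rabs_pos (g x)).
  assert (HNM : 0 <= N * M) by (apply Rmult_le_pos; lra).
  split.
  - rewrite Rabs_mult. apply Rle_trans with (N * M); [|lra].
    apply Rmult_le_compat; trivial.
  - replace (f x * g x - f y * g y) with ((f x - f y) * g x + f y * (g x - g y)) by ring.
    eapply Rle_trans; [apply Rabs_triang|]. rewrite !Rabs_mult.
    replace (2 * (N * M) * B) with (N * B * M + N * (M * B)) by ring.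
    apply Rplus_le_compat; apply Rmult_le_compat; trivial; apply Rabs_pos.
Qed.

Lemma tame_v1 : tame (fun x => fst (fst (fst x))).
Proof.
  exists (Rmax 1 d). intros [[[x1 x2] x3] x4] [[[y1 y2] y3] y4] B (X & _) _ HB.
  assert (H := near4_nonneg _ _ _ HB). destruct HB as (HB & _). simpl.
  assert (H1 := Rmax_l 1 d). assert (H2 := Rmax_r 1 d). split; [lra|].
  apply Rle_trans with (1 * B); [lra|]. now apply Rmult_le_compat_r.
Qed.

Lemma tame_v2 : tame (fun x => snd (fst (fst x))).
Proof.
  exists (Rmax 1 d). intros [[[x1 x2] x3] x4] [[[y1 y2] y3] y4] B (_ & X & _) _ HB.
  assert (H := near4_nonneg _ _ _ HB). destruct HB as (_ & HB & _). simpl.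
  assert (H1 := Rmax_l 1 d). assert (H2 := Rmax_r 1 d). split; [lra|].
  apply Rle_trans with (1 * B); [lra|]. now apply Rmult_le_compat_r.
Qed.

End Tame.

Inductive coordinate : Set := V1 | V2 | Radius | Angle.

Definition point (s : coordinate -> R) : R4 := (s V1, s V2, s Radius, s Angle).

Definition component (i : coordinate) (x : R4) : R :=
  let '(v1, v2, r, phi) := x in
  match i with V1 => v1 | V2 => v2 | Radius => r | Angle => phi end.

Definition clamp (a b z : R) : R := Rmax a (Rmin b z).

Definition clamp_to_box (d : R) (x : R4) : R4 :=
  let '(v1, v2, r, phi) := x in
  (clamp (- d) d v1, clamp (- d) d v2, clamp (- d) (1 + d) r, phi).

Lemma clamp_range a b z : a <= b -> a <= clamp a b z <= b.
Proof.
  intros H. unfold clamp. split; [apply Rmax_l|].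
  apply Rmax_lub; trivial. apply Rmin_l.
Qed.

Lemma clamp_id a b z : a <= z <= b -> clamp a b z = z.
Proof. intros H. unfold clamp. rewrite Rmin_right, Rmax_right; lra. Qed.

Lemma clamp_contracts a b y z : Rabs (clamp a b y - clamp a b z) <= Rabs (y - z).
Proof.
  unfold clamp, Rmax, Rmin.
  destruct (Rle_dec b y), (Rle_dec b z);
    repeat match goal with |- context [Rle_dec ?u ?v] => destruct (Rle_dec u v) end;
    unfold Rabs; repeat destruct (Rcase_abs _); lra.
Qed.

Lemma clamp_to_box_in_box d x : 0 < d -> in_box d (clamp_to_box d x).
Proof.
  intros Hd. destruct x as [[[v1 v2] r] phi]. simpl.
  rewrite !Rabs_le_between.
  repeat split; apply clamp_range; lra.
Qed.

Lemma clamp_to_box_id d x : in_box d x -> clamp_to_box d x = x.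
Proof.
  destruct x as [[[v1 v2] r] phi]. intros (H1 & H2 & H3). simpl.
  apply Rabs_le_between in H1. apply Rabs_le_between in H2.
  now rewrite !clamp_id by lra.
Qed.

Lemma local_field_tame S d m N i :
  uniform_bounds S d m N -> tame d (fun x => component i (local_field S x)).
Proof.
  intros [_ _ _ Hp Hv Ho Hp0 Hv0 Hr0 Ho0].
  assert (Tp : tame d (of_radius (p S))) by now exists N.
  assert (Tv : tame d (of_radius (vsigma S))) by now exists N.
  assert (To : tame d (of_radius (omega S))) by now exists N.
  assert (Tp0 : tame d (p_0 S)) by now exists N.
  assert (Tv0 : tame d (vsigma_0 S)) by now exists N.
  assert (Tr0 : tame d (r_0 S)) by now exists N.
  assert (To0 : tame d (omega_0 S)) by now exists N.
  assert (T1 := tame_v1 d). assert (T2 := tame_v2 d).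
  assert (T12 := tame_mult d _ _ T1 T2).
  destruct i.
  - refine (tame_ext d _ _ _ (tame_plus d _ _ (tame_mult d _ _ Tp T1)
      (tame_mult d _ _ (tame_mult d _ _ Tp0 T1) T12))).
    intros [[[v1 v2] r] phi]. simpl. ring.
  - refine (tame_ext d _ _ _ (tame_plus d _ _ (tame_mult d _ _ Tv T2)
      (tame_mult d _ _ (tame_mult d _ _ Tv0 T2) T12))).
    intros [[[v1 v2] r] phi]. simpl. ring.
  - refine (tame_ext d _ _ _ (tame_mult d _ _ T12 Tr0)).
    intros [[[v1 v2] r] phi]. simpl. ring.
  - refine (tame_ext d _ _ _ (tame_plus d _ _ To (tame_mult d _ _ T12 To0))).
    intros [[[v1 v2] r] phi]. simpl. ring.
Qed.

(** Composing with the retraction onto the box makes the field globally bounded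
    and Lipschitz without changing it in the box. *)
Lemma clamped_flow S d m N x0 :
  0 < d -> uniform_bounds S d m N ->
  exists g : R -> coordinate -> R, point (g 0) = x0 /\
    forall t i, 0 <= t ->
      is_derive (fun s => g s i) t
        (component i (local_field S (clamp_to_box d (point (g t))))).
Proof.
  intros Hd UB.
  assert (HT : exists M, 0 < M /\ forall i,
            bounded_lipschitz d M (fun x => component i (local_field S x))).
  { destruct (local_field_tame S d m N V1 UB) as [M1 H1].
    destruct (local_field_tame S d m N V2 UB) as [M2 H2].
    destruct (local_field_tame S d m N Radius UB) as [M3 H3].
    destruct (local_field_tame S d m N Angle UB) as [M4 H4].
    exists (1 + Rabs M1 + Rabs M2 + Rabs M3 + Rabs M4).
    generalize (Rabs_pos M1) (Rabs_pos M2) (Rabs_pos M3) (Rabs_pos M4)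
      (Rle_abs M1) (Rle_abs M2) (Rle_abs M3) (Rle_abs M4). intros.
    split; [lra|].
    intros []; eapply bounded_lipschitz_weaken;
      [apply Rle_refl| |eassumption|apply Rle_refl| |eassumption
      |apply Rle_refl| |eassumption|apply Rle_refl| |eassumption]; lra. }
  destruct HT as (M & HM & HL).
  destruct (global_solution coordinate
    (fun i s => component i (local_field S (clamp_to_box d (point s)))) M M
    (fun i => component i x0)) as (g & Hg0 & Hg).
  - exact HM.
  - intros i s. assert (Hs := clamp_to_box_in_box d (point s) Hd).
    exact (proj1 (HL i _ _ 0 Hs Hs (near4_refl _))).
  - intros s s' B HB i.
    apply (HL i); try now apply clamp_to_box_in_box.
    repeat split; try apply HB;
      (eapply Rle_trans; [apply clamp_contracts|apply HB]).
  - exists g. split; [|exact Hg].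
    unfold point. rewrite !Hg0. now destruct x0 as [[[? ?] ?] ?].
Qed.

(** While [v1 < h] the orbit of the clamped field stays in the box, where it is an
    orbit of the true field and [v1] grows exponentially; hence it reaches the
    section. *)
Lemma local_map_exists S delta d m N h xi r1 phi1 :
  uniform_bounds S d m N ->
  0 < d -> d < delta -> d <= 1 -> 0 < m -> 0 < N -> h < d -> 4 * N * h <= m * d ->
  0 < xi -> xi < h -> - d / 2 <= r1 <= 1 + d / 2 ->
  exists y, local_map S delta h (xi, r1, phi1) y.
Proof.
  intros UB Hd Hdd Hd1 Hm HN Hhd Hh Hxi Hxih Hr1.
  destruct (clamped_flow S d m N (section2 h (xi, r1, phi1)) Hd UB) as (g & Hg0 & Hg).
  pose (v1 := fun t => g t V1). pose (v2 := fun t => g t V2).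
  pose (r := fun t => g t Radius). pose (phi := fun t => g t Angle).
  injection Hg0 as S1 S2 S3 S4.
  fold (v1 0) in S1. fold (v2 0) in S2. fold (r 0) in S3. fold (phi 0) in S4.
  assert (Hc : forall t, 0 <= t -> continuous v1 t /\ continuous v2 t /\ continuous r t).
  { intros t Ht. repeat split; eapply is_derive_continuous;
      [apply (Hg t V1 Ht)|apply (Hg t V2 Ht)|apply (Hg t Radius Ht)]. }
  assert (Heqs : forall t, 0 <= t ->
            in_box d (v1 t, v2 t, r t, phi t) -> local_equations S v1 v2 r phi t).
  { intros t Ht Hx.
    assert (H := fun i => Hg t i Ht).
    change (point (g t)) with (v1 t, v2 t, r t, phi t) in H.
    rewrite (clamp_to_box_id d _ Hx) in H.
    exact (conj (H V1) (conj (H V2) (conj (H Radius) (H Angle)))). }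
  (* Within this time the lower bound for the growth of v1 reaches h. *)
  set (T1 := 2 / m * (ln h - ln xi)).
  assert (Hln : ln xi < ln h) by (apply ln_increasing; lra).
  assert (HT1 : 0 <= T1).
  { unfold T1. apply Rmult_le_pos; [|lra]. left; apply Rdiv_lt_0_compat; lra. }
  assert (Hreach : exists t, 0 <= t <= T1 /\ h <= v1 t).
  { apply NNPP. intros Hn.
    assert (Hlt : forall t, 0 <= t <= T1 -> v1 t < h).
    { intros t Ht. apply Rnot_le_lt. intros Hle. apply Hn. now exists t. }
    assert (Hgrow := orbit_grows S d m N h xi r1 UB Hd Hd1 Hm HN Hhd Hh Hxi
      (Rlt_le _ _ Hxih) Hr1 v1 v2 r phi T1 HT1 S1 S2 S3
      (fun t Ht => Hc t (proj1 Ht)) (fun t Ht => Heqs t (proj1 Ht))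
      (fun t Ht => Rlt_le _ _ (Hlt t Ht)) T1 (conj HT1 (Rle_refl T1))).
    replace (m / 2 * T1) with (ln h + - ln xi) in Hgrow by (unfold T1; field; lra).
    rewrite exp_plus, exp_Ropp, !exp_ln in Hgrow by lra.
    replace (xi * (h * / xi)) with h in Hgrow by (field; lra).
    generalize (Hlt T1 (conj HT1 (Rle_refl T1))). lra. }
  destruct Hreach as (T2 & HT2 & Hv).
  destruct (first_hitting_time v1 T2 h) as (T & HT & HvT & Hbelow); trivial; try lra.
  { intros t Ht. now apply Hc. }
  assert (Hle : forall t, 0 <= t <= T -> v1 t <= h).
  { intros t Ht. destruct (Rle_lt_or_eq_dec t T) as [Hl|He]; [lra| |].
    - left. apply Hbelow. lra.
    - subst t. lra. }
  assert (Hbox : forall t, 0 <= t <= T -> in_box d (v1 t, v2 t, r t, phi t))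
    by exact (orbit_in_box S d m N h xi r1 UB Hd Hd1 Hm HN Hhd Hh Hxi
      (Rlt_le _ _ Hxih) Hr1 v1 v2 r phi T ltac:(lra) S1 S2 S3
      (fun t Ht => Hc t (proj1 Ht)) (fun t Ht => Heqs t (proj1 Ht)) Hle).
  exists (v2 T, r T, phi T), (fun t => (v1 t, v2 t, r t, phi t)), T.
  refine (conj (proj1 HT) (conj _ (conj _ (conj (fun t Ht => conj _ _) Hbelow)))).
  - now rewrite S1, S2, S3, S4.
  - simpl. now rewrite HvT.
  - assert (H := Hbox t Ht). simpl in *. lra.
  - destruct (Heqs t ltac:(lra) (Hbox t ltac:(lra))) as (H1 & H2 & H3 & H4).
    exact (is_derive_pair _ _ t _ _ (is_derive_pair _ _ t _ _
             (is_derive_pair _ _ t _ _ H1 H2) H3) H4).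
Qed.

(** * The global map to first order *)

Definition first_slope (f : R3 -> R) (r phi : R) : R :=
  Derive (fun v => f (v, r, phi)) 0.

(** The quotient of [f (v, r, phi) - f (0, r, phi)] by [v] is Lipschitz, and its
    value at [v = 0] is the slope: this gives a quadratic remainder and the
    Lipschitz dependence of the slope on [(r, phi)]. *)
Lemma analytic_at3_first_order f r0 phi0 :
  analytic_at3 f (0, r0, phi0) ->
  exists rho, 0 < rho /\ forall r phi, Rabs (r - r0) <= rho -> Rabs (phi - phi0) <= rho ->
    (forall B, Rabs (r - r0) <= B -> Rabs (phi - phi0) <= B ->
       Rabs (first_slope f r phi - first_slope f r0 phi0) <= B / rho) /\
    is_derive (fun v => f (v, r, phi)) 0 (first_slope f r phi) /\
    (forall v, Rabs v <= rho ->
       Rabs (f (v, r, phi) - f (0, r, phi) - v * first_slope f r phi) <= v ^ 2 / rho).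
Proof.
  intros Hf. destruct (analytic_at3_divide f r0 phi0 Hf) as (q & rho & Hrho & Hq & HL).
  exists rho. split; trivial.
  assert (Hquad : forall r phi v, Rabs (r - r0) <= rho -> Rabs (phi - phi0) <= rho ->
     Rabs v <= rho ->
     Rabs (f (v, r, phi) - f (0, r, phi) - v * q (0, r, phi)) <= v ^ 2 / rho).
  { intros r phi v Hr Hphi Hv.
    rewrite Hq by (repeat split; rewrite ?Rminus_0_r; trivial).
    rewrite <- Rmult_minus_distr_l, Rabs_mult.
    assert (H : Rabs (q (v, r, phi) - q (0, r, phi)) <= Rabs v / rho).
    { apply HL; repeat split; rewrite ?Rminus_0_r, ?Rminus_diag, ?Rabs_R0;
        trivial; try lra; apply Rabs_pos. }
    apply Rle_trans with (Rabs v * (Rabs v / rho)).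
    - apply Rmult_le_compat_l; [apply Rabs_pos|exact H].
    - rewrite <- (pow2_abs v). right. field. lra. }
  assert (Hder : forall r phi, Rabs (r - r0) <= rho -> Rabs (phi - phi0) <= rho ->
     is_derive (fun v => f (v, r, phi)) 0 (q (0, r, phi))).
  { intros r phi Hr Hphi. apply is_derive_Reals. intros eps Heps.
    assert (Hd : 0 < Rmin rho (eps * rho)).
    { apply Rmin_pos; trivial. now apply Rmult_lt_0_compat. }
    exists (mkposreal _ Hd). intros v Hv0 Hv. simpl in Hv.
    assert (H1 := Rmin_l rho (eps * rho)). assert (H2 := Rmin_r rho (eps * rho)).
    assert (H := Hquad r phi v Hr Hphi ltac:(lra)).
    rewrite Rplus_0_l.
    change (Rabs ((f (v, r, phi) - f (0, r, phi)) / v - q (0, r, phi)) < eps).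
    assert (Hva : 0 < Rabs v) by now apply Rabs_pos_lt.
    replace ((f (v, r, phi) - f (0, r, phi)) / v - q (0, r, phi))
      with ((f (v, r, phi) - f (0, r, phi) - v * q (0, r, phi)) / v)
      by (field; trivial).
    unfold Rdiv. rewrite Rabs_mult, Rabs_inv.
    apply Rmult_lt_reg_r with (Rabs v); trivial.
    rewrite Rmult_assoc, Rinv_l, Rmult_1_r by lra.
    eapply Rle_lt_trans; [exact H|].
    rewrite <- (pow2_abs v).
    apply Rmult_lt_reg_r with rho; trivial.
    replace (Rabs v ^ 2 / rho * rho) with (Rabs v * Rabs v) by (field; lra).
    replace (eps * Rabs v * rho) with (eps * rho * Rabs v) by ring.
    apply Rmult_lt_compat_r; lra. }
  assert (Hslope : forall r phi, Rabs (r - r0) <= rho -> Rabs (phi - phi0) <= rho ->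
     first_slope f r phi = q (0, r, phi)).
  { intros r phi Hr Hphi. now apply is_derive_unique, Hder. }
  assert (H0 : forall z, Rabs (z - z) <= rho).
  { intros z. rewrite Rminus_diag, Rabs_R0. lra. }
  intros r phi Hr Hphi. rewrite (Hslope r phi Hr Hphi), (Hslope r0 phi0); auto.
  refine (conj _ (conj (Hder r phi Hr Hphi) (fun v => Hquad r phi v Hr Hphi))).
  intros B HBr HBp. apply HL; repeat split; auto.
  rewrite Rminus_diag, Rabs_R0.
  eapply Rle_trans; [apply Rabs_pos|exact HBr].
Qed.

(** The point may be an end of the interval: the difference quotients on one side
    already determine the derivative. *)
Lemma derivative_zero_on_interval (u : R -> R) (t0 l lo hi : R) :
  lo < hi -> lo <= t0 <= hi -> is_derive u t0 l ->
  (forall t, lo <= t <= hi -> u t = 0) -> l = 0.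
Proof.
  intros Hlh Ht0 Hd Hu. apply NNPP. intros Hl.
  apply is_derive_Reals in Hd.
  destruct (Hd (Rabs l) (Rabs_pos_lt l Hl)) as [delta Hdelta].
  assert (Hpos := cond_pos delta).
  set (k := Rmin (delta / 2) ((hi - lo) / 2)).
  assert (Hk : 0 < k /\ k <= delta / 2 /\ k <= (hi - lo) / 2).
  { repeat split; [apply Rmin_pos; lra|apply Rmin_l|apply Rmin_r]. }
  assert (He : exists e, e <> 0 /\ Rabs e < delta /\ lo <= t0 + e <= hi).
  { destruct (Rle_lt_dec t0 ((lo + hi) / 2)).
    - exists k. rewrite Rabs_pos_eq; lra.
    - exists (- k). rewrite Rabs_Ropp, Rabs_pos_eq; lra. }
  destruct He as (e & He0 & He & Hin).
  specialize (Hdelta e He0 He). rewrite !Hu in Hdelta by lra.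
  replace ((0 - 0) / e - l) with (- l) in Hdelta by (field; trivial).
  rewrite Rabs_Ropp in Hdelta. lra.
Qed.

(** The cross product is in the kernel; if it vanishes, the forms are dependent
    and a coordinate plane contains a vector of the kernel. *)
Lemma two_forms_kernel (x1 x2 x3 y1 y2 y3 : R) :
  exists a b c, ~ (a = 0 /\ b = 0 /\ c = 0) /\
    a * x1 + b * x2 + c * x3 = 0 /\ a * y1 + b * y2 + c * y3 = 0.
Proof.
  set (m1 := x2 * y3 - x3 * y2). set (m2 := x3 * y1 - x1 * y3).
  set (m3 := x1 * y2 - x2 * y1).
  destruct (classic (m1 = 0 /\ m2 = 0 /\ m3 = 0)) as [(H1 & H2 & H3)|H].
  2:{ exists m1, m2, m3. split; [exact H|]. unfold m1, m2, m3. split; ring. }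
  unfold m1, m2, m3 in *.
  destruct (classic (x1 = 0 /\ x2 = 0)) as [[-> ->]|Hx].
  2:{ exists x2, (- x1), 0. split; [|split; lra].
      intros (E1 & E2 & _). apply Hx. split; lra. }
  destruct (classic (y1 = 0 /\ y2 = 0)) as [[-> ->]|Hy].
  { exists 1, 0, 0. split; [|split; lra]. intros (E & _). lra. }
  exists y2, (- y1), 0. split; [|split; lra].
  intros (E1 & E2 & _). apply Hy. split; lra.
Qed.

Lemma is_derive_along {U V : NormedModule R_AbsRing} (f : U -> V) (L : U -> V)
    (g : R -> U) (t : R) (e : U) :
  filterdiff f (locally (g t)) L -> is_derive g t e ->
  is_derive (fun s => f (g s)) t (L e).
Proof.
  intros Hf Hg.
  apply (filterdiff_ext_lin (U := R_NormedModule) _ (fun y => L (scal (y : R) e))).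
  - exact (filterdiff_comp' (U := R_NormedModule) (V := U) (W := V) g f t _ L Hg Hf).
  - intros y. apply (linear_scal L). exact (proj1 Hf).
Qed.

Section GlobalMap.

Variables (F Phi : R4 -> R4) (h : R) (G : R3 -> R3).
Hypothesis HG : global_map F Phi h G.

Definition G1 (x : R3) : R := let '(y, _, _) := G x in y.
Definition G2 (x : R3) : R := let '(_, y, _) := G x in y.
Definition G3 (x : R3) : R := let '(_, _, y) := G x in y.

Lemma channel_components r phi :
  0 <= r <= 1 -> G1 (0, r, phi) = 0 /\ 0 <= G2 (0, r, phi) <= 1.
Proof.
  intros Hr. destruct (global_channel _ _ _ _ HG r phi Hr) as (r' & phi' & Hr' & E).
  unfold G1, G2. now rewrite E.
Qed.

(** If the slope vanished, the whole differential of the first component would,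
    since that component is constant on the channel; the differential would then
    map into a plane. *)
Lemma slope_nonzero r phi :
  0 <= r <= 1 -> is_derive (fun v => G1 (v, r, phi)) 0 (first_slope G1 r phi) ->
  first_slope G1 r phi <> 0.
Proof.
  intros Hr Hslope H0. rewrite H0 in Hslope.
  destruct (global_immersive _ _ _ _ HG r phi Hr) as (L & HL & Hinj).
  assert (Hlin := proj1 HL).
  assert (HC : forall (g : R -> R3) t (e : R3), g t = (0, r, phi) -> is_derive g t e ->
     is_derive (fun s => G1 (g s)) t (fst (fst (L e)))).
  { intros g t e Hg He.
    assert (HL' : filterdiff G (locally (g t)) L) by (rewrite Hg; exact HL).
    assert (H := is_derive_along G L g t e HL' He).
    apply (is_derive_ext (fun s => fst (fst (G (g s))))).
    { intros s. unfold G1. now destruct (G (g s)) as [[? ?] ?]. }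
    exact (is_derive_fst (U := R_NormedModule) (V := R_NormedModule) _ t _
       (is_derive_fst (U := prod_NormedModule R_AbsRing R_NormedModule R_NormedModule)
          (V := R_NormedModule) _ t _ H)). }
  assert (Hid : forall t, is_derive (fun s : R => s) t 1).
  { intros t. apply (is_derive_id (K := R_AbsRing)). }
  assert (Hconst : forall (c t : R), is_derive (fun _ : R => c) t 0).
  { intros c t. apply (is_derive_const (V := R_NormedModule)). }
  assert (D1 : fst (fst (L ((1, 0, 0) : R3))) = 0).
  { apply eq_trans with (Derive (fun v => G1 (v, r, phi)) 0);
      [symmetry|]; apply is_derive_unique; [|exact Hslope].
    apply (HC (fun v => (v, r, phi))); trivial.
    exact (is_derive_pair _ _ _ _ _ (is_derive_pair _ _ _ _ _ (Hid 0) (Hconst r 0))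
             (Hconst phi 0)). }
  assert (D2 : fst (fst (L ((0, 1, 0) : R3))) = 0).
  { apply (derivative_zero_on_interval (fun s => G1 (0, s, phi)) r _ 0 1); [lra|lra| |].
    - apply (HC (fun s => (0, s, phi))); trivial.
      exact (is_derive_pair _ _ _ _ _ (is_derive_pair _ _ _ _ _ (Hconst 0 r) (Hid r))
             (Hconst phi r)).
    - intros t Ht. now apply channel_components. }
  assert (D3 : fst (fst (L ((0, 0, 1) : R3))) = 0).
  { apply (derivative_zero_on_interval (fun s => G1 (0, r, s)) phi _ phi (phi + 1));
      [lra|lra| |].
    - apply (HC (fun s => (0, r, s))); trivial.
      exact (is_derive_pair _ _ _ _ _ (is_derive_pair _ _ _ _ _ (Hconst 0 phi)
               (Hconst r phi)) (Hid phi)).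
    - intros t Ht. now apply channel_components. }
  destruct (L ((1, 0, 0) : R3)) as [[z1 x1] y1] eqn:E1.
  destruct (L ((0, 1, 0) : R3)) as [[z2 x2] y2] eqn:E2.
  destruct (L ((0, 0, 1) : R3)) as [[z3 x3] y3] eqn:E3.
  simpl in D1, D2, D3. subst z1 z2 z3.
  destruct (two_forms_kernel x1 x2 x3 y1 y2 y3) as (a & b & c & Hn & Hx & Hy).
  apply Hn.
  assert (Hz : ((a, b, c) : R3) = zero).
  { apply Hinj.
    replace ((a, b, c) : R3) with
      (plus (plus (scal a ((1, 0, 0) : R3)) (scal b ((0, 1, 0) : R3)))
         (scal c ((0, 0, 1) : R3))).
    - rewrite !(linear_plus L Hlin), !(linear_scal L Hlin), E1, E2, E3.
      unfold plus, scal, zero; simpl; unfold prod_plus, prod_scal, prod_zero; simpl.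
      unfold plus, scal, zero; simpl; unfold prod_plus, prod_scal, prod_zero; simpl.
      unfold plus, scal, zero; simpl; unfold mult; simpl.
      f_equal; [f_equal|]; lra.
    - unfold plus, scal; simpl; unfold prod_plus, prod_scal; simpl.
      unfold plus, scal; simpl; unfold prod_plus, prod_scal; simpl.
      unfold plus, scal; simpl; unfold mult; simpl.
      f_equal; [f_equal|]; ring. }
  unfold zero in Hz; simpl in Hz; unfold prod_zero in Hz; simpl in Hz.
  now injection Hz.
Qed.

(** The first component is positive for [v > 0], which a negative slope would
    contradict. *)
Lemma slope_positive r phi :
  0 <= r <= 1 -> 0 < first_slope G1 r phi.
Proof.
  intros Hr.
  destruct (global_analytic _ _ _ _ HG r phi Hr) as (Ha & _).
  destruct (analytic_at3_first_order G1 r phi Ha) as (rho & Hrho & H).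
  destruct (H r phi) as (_ & Hd & Hv); try (rewrite Rminus_diag, Rabs_R0; lra).
  assert (Hn := slope_nonzero r phi Hr Hd).
  destruct (Rtotal_order (first_slope G1 r phi) 0) as [Hl|[He|Hg]]; trivial;
    [exfalso|contradiction].
  set (a := first_slope G1 r phi) in *.
  destruct (global_flow _ _ _ _ HG) as (eps & Heps & Hflow).
  set (v := Rmin (Rmin rho (eps / 2)) (- a * rho)).
  assert (Hv0 : 0 < v).
  { repeat apply Rmin_pos; try lra. apply Rmult_lt_0_compat; lra. }
  assert (Hv1 : v <= rho) by (eapply Rle_trans; [apply Rmin_l|apply Rmin_l]).
  assert (Hv2 : v <= eps / 2) by (eapply Rle_trans; [apply Rmin_l|apply Rmin_r]).
  assert (Hv3 : v <= - a * rho) by apply Rmin_r.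
  destruct (Hflow v r phi ltac:(lra) Hr) as [_ (w & r' & phi' & k & E & _ & Hw)].
  specialize (Hw Hv0). specialize (Hv v). rewrite Rabs_pos_eq in Hv by lra.
  specialize (Hv Hv1). rewrite (proj1 (channel_components r phi Hr)) in Hv.
  assert (EG : G1 (v, r, phi) = w) by (unfold G1; now rewrite E).
  rewrite EG in Hv. apply Rabs_le_between in Hv.
  assert (v ^ 2 / rho <= - a * v); [|lra].
  apply Rmult_le_reg_r with rho; trivial.
  replace (v ^ 2 / rho * rho) with (v * v) by (field; lra).
  replace (- a * v * rho) with (- a * rho * v) by ring.
  apply Rmult_le_compat_r; lra.
Qed.

Definition first_order_at (rho r phi : R) : Prop :=
  rho <= first_slope G1 r phi <= / rho /\
  forall v, 0 <= v <= rho ->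
    Rabs (G1 (v, r, phi) - v * first_slope G1 r phi) <= v ^ 2 / rho /\
    Rabs (G2 (v, r, phi) - G2 (0, r, phi)) <= v / rho /\
    Rabs (G3 (v, r, phi) - G3 (0, r, phi)) <= v / rho.

Lemma first_order_local r0 phi0 :
  0 <= r0 <= 1 ->
  exists rho, 0 < rho /\ forall r phi, Rabs (r - r0) < rho -> Rabs (phi - phi0) < rho ->
    0 <= r <= 1 -> first_order_at rho r phi.
Proof.
  intros Hr0.
  destruct (global_analytic _ _ _ _ HG r0 phi0 Hr0) as (A1 & A2 & A3).
  destruct (analytic_at3_first_order G1 r0 phi0 A1) as (rho1 & Hrho1 & H1).
  destruct (analytic_at3_first_order G2 r0 phi0 A2) as (rho2 & Hrho2 & H2).
  destruct (analytic_at3_first_order G3 r0 phi0 A3) as (rho3 & Hrho3 & H3).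
  assert (Ha := slope_positive r0 phi0 Hr0).
  set (a := first_slope G1 r0 phi0) in *.
  set (b := first_slope G2 r0 phi0) in *. set (c := first_slope G3 r0 phi0) in *.
  assert (Hb := Rabs_pos b). assert (Hc := Rabs_pos c).
  assert (I1 : 0 < / rho1) by now apply Rinv_0_lt_compat.
  assert (I2 : 0 < / rho2) by now apply Rinv_0_lt_compat.
  assert (I3 : 0 < / rho3) by now apply Rinv_0_lt_compat.
  assert (Ia : 0 < / a) by now apply Rinv_0_lt_compat.
  assert (I1a : 0 < / rho1 * / a) by now apply Rmult_lt_0_compat.
  (* The inverse of the common size; every summand enforces one inequality. *)
  set (M := / rho1 + / rho2 + / rho3 + 2 * a + 2 * / a + 2 * (/ rho1 * / a)
            + Rabs b + Rabs c + 2).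
  assert (HM : 0 < M) by (unfold M; lra).
  set (rho := / M).
  assert (Hrho : 0 < rho) by now apply Rinv_0_lt_compat.
  assert (Hinv : / rho = M) by apply Rinv_inv.
  assert (Hsmall : forall z, 0 < z -> / z <= M -> rho <= z).
  { intros z Hz HzM. rewrite <- (Rinv_inv z). apply Rinv_le_contravar; trivial.
    now apply Rinv_0_lt_compat. }
  assert (L1 : rho <= rho1) by (apply Hsmall; trivial; unfold M; lra).
  assert (L2 : rho <= rho2) by (apply Hsmall; trivial; unfold M; lra).
  assert (L3 : rho <= rho3) by (apply Hsmall; trivial; unfold M; lra).
  assert (L4 : rho <= a / 2).
  { apply Hsmall; [lra|]. replace (/ (a / 2)) with (2 * / a) by (field; lra).
    unfold M; lra. }
  assert (L5 : rho / rho1 <= a / 2).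
  { assert (rho <= rho1 * a / 2).
    { apply Hsmall; [apply Rdiv_lt_0_compat; [now apply Rmult_lt_0_compat|lra]|].
      replace (/ (rho1 * a / 2)) with (2 * (/ rho1 * / a)) by (field; lra).
      unfold M; lra. }
    apply Rmult_le_reg_r with rho1; trivial.
    replace (rho / rho1 * rho1) with rho by (field; lra). lra. }
  assert (Hone : forall z, rho <= z -> rho / z <= 1).
  { intros z Hz. apply Rmult_le_reg_r with z; [lra|].
    replace (rho / z * z) with rho by (field; lra). lra. }
  exists rho. split; trivial. intros r phi Hr Hphi Hr01.
  destruct (H1 r phi) as (S1 & _ & Q1); try lra.
  destruct (H2 r phi) as (S2 & _ & Q2); try lra.
  destruct (H3 r phi) as (S3 & _ & Q3); try lra.
  specialize (S1 rho ltac:(lra) ltac:(lra)).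
  specialize (S2 rho ltac:(lra) ltac:(lra)).
  specialize (S3 rho ltac:(lra) ltac:(lra)).
  rewrite (proj1 (channel_components r phi Hr01)) in Q1.
  assert (Hlin : forall (f : R3 -> R) z s v, 0 < z -> rho <= z ->
     Rabs (first_slope f r phi - s) <= rho / z -> Rabs s + 2 <= M ->
     0 <= v <= rho ->
     Rabs (f (v, r, phi) - f (0, r, phi) - v * first_slope f r phi) <= v ^ 2 / z ->
     Rabs (f (v, r, phi) - f (0, r, phi)) <= v / rho).
  { intros f z s v Hz Hrz Hs HsM Hv Hq.
    assert (Hs' : Rabs (first_slope f r phi) <= Rabs s + 1).
    { replace (first_slope f r phi) with (s + (first_slope f r phi - s)) by ring.
      eapply Rle_trans; [apply Rabs_triang|]. generalize (Hone z Hrz); lra. }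
    assert (Hvz : v ^ 2 / z <= v * 1).
    { replace (v ^ 2 / z) with (v * (v / z)) by (field; lra).
      apply Rmult_le_compat_l; [lra|]. eapply Rle_trans; [|apply (Hone z Hrz)].
      apply Rmult_le_compat_r; [left; now apply Rinv_0_lt_compat|lra]. }
    replace (f (v, r, phi) - f (0, r, phi))
      with ((f (v, r, phi) - f (0, r, phi) - v * first_slope f r phi)
            + v * first_slope f r phi) by ring.
    eapply Rle_trans; [apply Rabs_triang|].
    rewrite Rabs_mult, (Rabs_pos_eq v) by lra.
    unfold Rdiv; rewrite Hinv.
    apply Rle_trans with (v * (1 + Rabs (first_slope f r phi))); [lra|].
    apply Rmult_le_compat_l; lra. }
  split.
  - rewrite Hinv. apply Rabs_le_between in S1.
    split; [lra|]. unfold M. lra.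
  - intros v Hv. assert (Hva : Rabs v = v) by (apply Rabs_pos_eq; lra).
    specialize (Q1 v). specialize (Q2 v). specialize (Q3 v). rewrite Hva in Q1, Q2, Q3.
    repeat split.
    + rewrite Rminus_0_r in Q1. eapply Rle_trans; [apply Q1; lra|].
      apply Rmult_le_compat_l; [apply pow2_ge_0|]. apply Rinv_le_contravar; lra.
    + apply (Hlin G2 rho2 b); trivial; [unfold M; lra|apply Q2; lra].
    + apply (Hlin G3 rho3 c); trivial; [unfold M; lra|apply Q3; lra].
Qed.

Lemma first_order_uniform :
  exists rho, 0 < rho /\ forall r phi, 0 <= r <= 1 -> 0 <= phi <= 1 ->
    first_order_at rho r phi.
Proof.
  destruct (compact_uniform_size 2 (0, (0, tt)) (1, (1, tt))
    (fun rho x => let '(r, (phi, _)) := x in 0 <= r <= 1 -> first_order_at rho r phi))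
    as (rho & Hrho & H).
  - intros [r0 [phi0 []]] (Hr & _).
    destruct (first_order_local r0 phi0 Hr) as (rho & Hrho & H).
    exists rho. split; trivial. intros [r [phi []]] (H1 & H2 & _). now apply H.
  - intros rho rho' [r [phi []]] [Hrho' Hle] H Hr.
    destruct (H Hr) as [Ha Hv].
    assert (Hi : / rho <= / rho') by (apply Rinv_le_contravar; lra).
    split; [lra|]. intros v Hv0.
    destruct (Hv v ltac:(lra)) as (V1 & V2 & V3).
    assert (E1 : v ^ 2 / rho <= v ^ 2 / rho')
      by (apply Rmult_le_compat_l; trivial; apply pow2_ge_0).
    assert (E2 : v / rho <= v / rho') by (apply Rmult_le_compat_l; lra).
    repeat split; lra.
  - exists rho. split; trivial. intros r phi Hr Hphi.
    apply (H (r, (phi, tt))); simpl; auto.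
Qed.

(** Positive translations iterate the translation by 1; negative ones invert
    them. *)
Lemma global_map_translate :
  exists eps, 0 < eps /\
  forall v r phi (n : Z), 0 <= v < eps -> 0 <= r <= 1 ->
    (0 < v -> 0 < G1 (v, r, phi)) /\
    exists k : Z, G (v, r, phi + IZR n)
      = (G1 (v, r, phi), G2 (v, r, phi), G3 (v, r, phi) + IZR k).
Proof.
  destruct (global_flow _ _ _ _ HG) as (eps & Heps & Hflow).
  exists eps. split; trivial. intros v r phi n Hv Hr.
  assert (Hstep : forall psi, exists k : Z,
    G (v, r, psi + 1) = (G1 (v, r, psi), G2 (v, r, psi), G3 (v, r, psi) + IZR k)).
  { intros psi. destruct (Hflow v r psi Hv Hr) as [_ (w & r' & phi' & k & E & E' & _)].
    exists k. unfold G1, G2, G3. now rewrite E, E'. }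
  split.
  { intros Hv0. destruct (Hflow v r phi Hv Hr) as [_ (w & r' & phi' & k & E & _ & Hw)].
    unfold G1. rewrite E. auto. }
  assert (Hnat : forall m psi, exists k : Z, G (v, r, psi + INR m)
      = (G1 (v, r, psi), G2 (v, r, psi), G3 (v, r, psi) + IZR k)).
  { induction m as [|m IH]; intros psi.
    - exists 0%Z. rewrite !Rplus_0_r. unfold G1, G2, G3.
      now destruct (G (v, r, psi)) as [[? ?] ?].
    - destruct (IH psi) as [k Hk]. destruct (Hstep (psi + INR m)) as [k' Hk'].
      exists (k + k')%Z. rewrite S_INR, <- Rplus_assoc, Hk'.
      unfold G1 at 1, G2 at 1, G3 at 1. rewrite Hk, plus_IZR, Rplus_assoc. reflexivity. }
  destruct (Z_le_gt_dec 0 n) as [Hn|Hn].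
  - destruct (Hnat (Z.to_nat n) phi) as [k Hk].
    rewrite INR_IZR_INZ, Z2Nat.id in Hk by lia. now exists k.
  - destruct (Hnat (Z.to_nat (- n)) (phi + IZR n)) as [k Hk].
    rewrite INR_IZR_INZ, Z2Nat.id, opp_IZR in Hk by lia.
    replace (phi + IZR n + - IZR n) with phi in Hk by ring.
    exists (- k)%Z. rewrite opp_IZR. unfold G1, G2, G3. rewrite Hk.
    destruct (G (v, r, phi + IZR n)) as [[? ?] ?] eqn:E.
    unfold G1, G2, G3. rewrite E. f_equal. ring.
Qed.

End GlobalMap.

(** * The normal form *)

Lemma frac_part_plus_1 phi : frac_part (phi + 1) = frac_part phi.
Proof.
  unfold frac_part.
  assert (H1 := base_Int_part (phi + 1)). assert (H2 := base_Int_part phi).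
  assert (E : Int_part (phi + 1) = (Int_part phi + 1)%Z).
  { assert (Int_part (phi + 1) < Int_part phi + 2)%Z
      by (apply lt_IZR; rewrite plus_IZR; lra).
    assert (Int_part phi < Int_part (phi + 1))%Z by (apply lt_IZR; lra).
    lia. }
  rewrite E, plus_IZR. ring.
Qed.

Lemma ln_near_1 y : / 2 <= y -> Rabs (ln y) <= 2 * Rabs (y - 1).
Proof.
  intros Hy.
  assert (H1 := exp_ineq1_le (ln y)). rewrite exp_ln in H1 by lra.
  assert (H2 := exp_ineq1_le (- ln y)). rewrite exp_Ropp, exp_ln in H2 by lra.
  assert (Hi : / y <= 2) by (rewrite <- (Rinv_inv 2); apply Rinv_le_contravar; lra).
  assert (Hi0 : 0 < / y) by (apply Rinv_0_lt_compat; lra).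
  assert (E : 1 - / y = / y * (y - 1)) by (field; lra).
  assert (Ha := Rle_abs (y - 1)). assert (Ha' := Rle_abs (- (y - 1))).
  rewrite Rabs_Ropp in Ha'.
  apply Rabs_le_between. split; [|lra].
  assert (/ y * - (y - 1) <= / y * Rabs (y - 1)) by (apply Rmult_le_compat_l; lra).
  assert (/ y * Rabs (y - 1) <= 2 * Rabs (y - 1))
    by (apply Rmult_le_compat_r; [apply Rabs_pos|lra]).
  lra.
Qed.

Lemma Rpower_le_self y e : 0 < y <= 1 -> 1 <= e -> 0 < Rpower y e <= y.
Proof.
  intros Hy He. split; [apply exp_pos|].
  assert (Hl : ln y <= 0).
  { rewrite <- ln_1. destruct (Req_dec y 1) as [->|Hn]; [lra|].
    left. apply ln_increasing; lra. }
  assert (Hle : e * ln y <= ln y) by nra.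
  rewrite <- (exp_ln y) at 2 by lra. unfold Rpower.
  destruct Hle as [Hlt|Heq]; [left; now apply exp_increasing|rewrite Heq; lra].
Qed.

Theorem mainTheorem2 :
  forall (F Phi : R4 -> R4) (S : local_system) (delta : R),
    homoclinic_setting F Phi S delta ->
    exists h0 : R, 0 < h0 /\
      forall h : R, 0 < h < h0 ->
      forall G : R3 -> R3, global_map F Phi h G ->
        has_normal_form S h (return_map S delta h G).
Proof.
  intros F Phi S delta [_ _ Hdelta _ _ _ _ _ _ _ HS _ Hsign].
  destruct (exists_uniform_bounds S delta Hdelta HS Hsign)
    as (d & m & N & Hd & Hd1 & Hm & HN & UB).
  assert (HmdN : 0 < m * d / (4 * N)).
  { apply Rdiv_lt_0_compat; [apply Rmult_lt_0_compat|]; lra. }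
  exists (Rmin d (m * d / (4 * N))). split; [apply Rmin_pos; lra|].
  intros h [Hh0 Hh] G HG.
  assert (Hhd : h < d) by (eapply Rlt_le_trans; [exact Hh|apply Rmin_l]).
  assert (HhN : 4 * N * h <= m * d).
  { replace (m * d) with (4 * N * (m * d / (4 * N))) by (field; lra).
    apply Rmult_le_compat_l; [lra|].
    left. eapply Rlt_le_trans; [exact Hh|apply Rmin_r]. }
  destruct (first_order_uniform F Phi h G HG) as (rho & Hrho & Hfirst).
  destruct (global_map_translate F Phi h G HG) as (epsG & HepsG & Htrans).
  (* Reducing the angle to the unit interval makes these functions periodic. *)
  pose (a1 := fun r phi => first_slope (G1 G) r (frac_part phi)).
  pose (b0 := fun r phi => G2 G (0, r, frac_part phi)).
  pose (c0 := fun r phi => G3 G (0, r, frac_part phi)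
                - omega S (b0 r phi) / p S (b0 r phi) * ln (a1 r phi)).
  exists a1, b0, c0. split.
  { intros r phi Hr. unfold c0, b0, a1. rewrite frac_part_plus_1.
    split; [now apply (slope_positive F Phi h G HG)|].
    split; [now apply (channel_components F Phi h G HG)|]. now repeat split. }
  assert (Hi : 0 < / rho) by now apply Rinv_0_lt_compat.
  assert (Hii : 0 < / rho * / rho) by now apply Rmult_lt_0_compat.
  assert (HNm : 0 < N / m) by now apply Rdiv_lt_0_compat.
  set (K := (1 + N / m) * N * (2 / m)).
  assert (H2m : 0 < 2 / m) by (apply Rdiv_lt_0_compat; lra).
  assert (HK : 0 < K) by (repeat apply Rmult_lt_0_compat; lra).
  (* The summands bound the errors of v2 and r, then in the angle those of the
     passage, of the global map and of ln xi. *)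
  set (C := 3 / rho + K * 10 / rho + 1 / rho + 2 * (N / m) * (/ rho * / rho)).
  assert (HKr : 0 < K * 10 / rho) by (apply Rmult_lt_0_compat; lra).
  assert (HNr : 0 < 2 * (N / m) * (/ rho * / rho)) by (apply Rmult_lt_0_compat; lra).
  (* Below epsG and rho the expansions of the global map hold. The other bounds
     ensure in turn xi >= v * a1 / 2, xi < h, a radius in the range of the
     passage estimates, ln (h / xi) <= - 2 * ln v and v <= |v * ln v|. *)
  set (eps := Rmin epsG (Rmin rho (Rmin (rho * rho / 2) (Rmin (h * rho / 4)
                (Rmin (d * rho / 2) (Rmin (rho / (2 * h)) (exp (- 1)))))))).
  exists C, eps.
  assert (Hrr : 0 < rho * rho) by now apply Rmult_lt_0_compat.
  assert (Hhr : 0 < h * rho) by now apply Rmult_lt_0_compat.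
  assert (Hdr : 0 < d * rho) by (apply Rmult_lt_0_compat; lra).
  split.
  { repeat apply Rmin_pos; try lra; [|apply exp_pos]. apply Rdiv_lt_0_compat; lra. }
  intros v r phi [Hv Hve] Hr.
  assert (V0 : v < epsG) by (eapply Rlt_le_trans; [exact Hve|apply Rmin_l]).
  assert (Hve1 := Rlt_le_trans _ _ _ Hve (Rmin_r _ _)).
  assert (V1 : v < rho) by (eapply Rlt_le_trans; [exact Hve1|apply Rmin_l]).
  assert (Hve2 := Rlt_le_trans _ _ _ Hve1 (Rmin_r _ _)).
  assert (V2 : v < rho * rho / 2) by (eapply Rlt_le_trans; [exact Hve2|apply Rmin_l]).
  assert (Hve3 := Rlt_le_trans _ _ _ Hve2 (Rmin_r _ _)).
  assert (V3 : v < h * rho / 4) by (eapply Rlt_le_trans; [exact Hve3|apply Rmin_l]).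
  assert (Hve4 := Rlt_le_trans _ _ _ Hve3 (Rmin_r _ _)).
  assert (V4 : v < d * rho / 2) by (eapply Rlt_le_trans; [exact Hve4|apply Rmin_l]).
  assert (Hve5 := Rlt_le_trans _ _ _ Hve4 (Rmin_r _ _)).
  assert (V5 : v < rho / (2 * h)) by (eapply Rlt_le_trans; [exact Hve5|apply Rmin_l]).
  assert (V6 := Rlt_le_trans _ _ _ Hve5 (Rmin_r _ _)).
  clear Hve Hve1 Hve2 Hve3 Hve4 Hve5.
  assert (Hln : ln v < - 1).
  { rewrite <- (ln_exp (- 1)). now apply ln_increasing. }
  assert (Hpsi : 0 <= frac_part phi <= 1) by (generalize (base_fp phi); lra).
  assert (Ephi : phi = frac_part phi + IZR (Int_part phi)) by (unfold frac_part; ring).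
  destruct (Htrans v r (frac_part phi) (Int_part phi) ltac:(lra) Hr) as [Hpos [k Hk]].
  rewrite <- Ephi in Hk. specialize (Hpos Hv).
  destruct (Hfirst r (frac_part phi) Hr Hpsi) as [Ha Hf].
  destruct (Hf v ltac:(lra)) as (F1 & F2 & F3). clear Hf.
  destruct (channel_components F Phi h G HG r (frac_part phi) Hr) as [_ Hb].
  change (first_slope (G1 G) r (frac_part phi)) with (a1 r phi) in *.
  change (G2 G (0, r, frac_part phi)) with (b0 r phi) in *.
  assert (Ec : c0 r phi = G3 G (0, r, frac_part phi)
                - omega S (b0 r phi) / p S (b0 r phi) * ln (a1 r phi)) by reflexivity.
  set (a := a1 r phi) in *. set (b := b0 r phi) in *.
  set (xi := G1 G (v, r, frac_part phi)) in *.
  set (s := G2 G (v, r, frac_part phi)) in *.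
  set (psi := G3 G (v, r, frac_part phi)) in *.
  set (psi0 := G3 G (0, r, frac_part phi)) in *.
  assert (Hvr : v / rho * rho = v) by (field; lra).
  assert (Hva : 0 < v * a <= v / rho).
  { split; [apply Rmult_lt_0_compat; lra|]. apply Rmult_le_compat_l; lra. }
  assert (Hquad : v ^ 2 / rho <= v * a / 2).
  { apply Rmult_le_reg_r with rho; trivial.
    replace (v ^ 2 / rho * rho) with (v * v) by (field; lra).
    replace (v * a / 2 * rho) with (v * (a * rho / 2)) by field.
    apply Rmult_le_compat_l; [lra|].
    assert (rho * rho <= a * rho) by (apply Rmult_le_compat_r; lra). lra. }
  assert (Hxi : v * a / 2 <= xi <= 2 * (v / rho)).
  { assert (H := proj1 (Rabs_le_between _ _) (Rle_trans _ _ _ F1 Hquad)). lra. }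
  assert (Hv3 : 2 * (v / rho) < h).
  { apply Rmult_lt_reg_r with rho; trivial. lra. }
  assert (Hv4 : v / rho <= d / 2).
  { apply Rmult_le_reg_r with rho; trivial. lra. }
  assert (Hs : - d / 2 <= s <= 1 + d / 2).
  { assert (H := proj1 (Rabs_le_between _ _) F2). lra. }
  assert (Hxih : xi < h) by lra.
  (* The linear part of the global map in logarithmic form. *)
  assert (Hlnxi : Rabs (ln v + ln a - ln xi) <= 2 * (/ rho * / rho) * v).
  { rewrite Rabs_minus_sym, <- ln_mult by lra.
    unfold Rminus at 1. rewrite <- ln_Rinv, <- ln_mult by
      (try apply Rinv_0_lt_compat; lra).
    assert (E : xi * / (v * a) - 1 = (xi - v * a) * / (v * a)) by (field; lra).
    assert (Hinva : 0 < / (v * a)) by (apply Rinv_0_lt_compat; lra).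
    eapply Rle_trans; [apply ln_near_1|].
    - apply Rmult_le_reg_r with (v * a); [lra|].
      rewrite Rmult_assoc, Rinv_l by lra. lra.
    - rewrite E, Rabs_mult, (Rabs_pos_eq (/ (v * a))) by lra.
      rewrite Rmult_assoc. apply Rmult_le_compat_l; [lra|].
      apply Rle_trans with (v ^ 2 / rho * / (v * a)).
      + apply Rmult_le_compat_r; lra.
      + replace (v ^ 2 / rho * / (v * a)) with (/ rho * v * / a) by (field; lra).
        replace (/ rho * / rho * v) with (/ rho * v * / rho) by ring.
        apply Rmult_le_compat_l; [apply Rmult_le_pos; lra|].
        apply Rinv_le_contravar; lra. }
  assert (Hlog : ln h - ln xi <= 2 * - ln v).
  { assert (ln (v * (rho / 2)) <= ln xi).
    { assert (Hle : v * (rho / 2) <= xi).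
      { apply Rle_trans with (v * a / 2); [|lra].
        replace (v * a / 2) with (v * (a / 2)) by field.
        apply Rmult_le_compat_l; lra. }
      destruct Hle as [Hlt|Heq]; [left|rewrite Heq; lra].
      apply ln_increasing; [apply Rmult_lt_0_compat; lra|exact Hlt]. }
    assert (ln v <= ln (rho / 2 * / h)).
    { left. apply ln_increasing; trivial.
      replace (rho / 2 * / h) with (rho / (2 * h)) by (field; lra). exact V5. }
    assert (0 < / h) by now apply Rinv_0_lt_compat.
    rewrite ln_mult in * by lra. rewrite ln_Rinv in * by lra. lra. }
  assert (Hvln : v <= Rabs (v * ln v)).
  { rewrite Rabs_mult, Rabs_pos_eq, Rabs_left by lra.
    rewrite <- (Rmult_1_r v) at 1. apply Rmult_le_compat_l; lra. }
  assert (Hvln' : Rabs (v * ln v) = v * - ln v).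
  { rewrite Rabs_mult, Rabs_pos_eq, Rabs_left by lra. reflexivity. }
  unfold return_map. rewrite Hk. split.
  { apply (local_map_exists S delta d m N h xi s (psi + IZR k)); trivial; lra. }
  intros v2' r' phi' Hloc. cbv zeta.
  destruct (local_map_estimates S delta d m N h xi s (psi + IZR k) v2' r' phi' b
              UB ltac:(lra) Hd1 Hm HN Hhd HhN ltac:(lra) ltac:(lra) Hs Hb Hloc)
    as (L1 & L2 & L3).
  change (b0 r phi) with b. change (a1 r phi) with a.
  assert (Hpb := p_lower _ _ _ _ UB b ltac:(lra)).
  assert (Htr := trace_upper _ _ _ _ UB b ltac:(lra)).
  split; [|split].
  - (* Both terms are of order v: the exponent is at least 1. *)
    assert (HP : 0 < Rpower (v * a / h) (- vsigma S b / p S b) <= v * a / h).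
    { apply Rpower_le_self.
      - split; [apply Rdiv_lt_0_compat; lra|].
        apply Rmult_le_reg_r with h; trivial.
        replace (v * a / h * h) with (v * a) by (field; lra). lra.
      - apply Rmult_le_reg_r with (p S b); [lra|].
        replace (- vsigma S b / p S b * p S b) with (- vsigma S b) by (field; lra).
        lra. }
    set (P := Rpower (v * a / h) (- vsigma S b / p S b)) in *.
    assert (HhP : 0 <= h * P <= v * a).
    { split; [apply Rmult_le_pos; lra|].
      replace (v * a) with (h * (v * a / h)) by (field; lra).
      apply Rmult_le_compat_l; lra. }
    apply Rle_trans with (3 / rho * v).
    + replace (3 / rho * v) with (3 * (v / rho)) by (field; lra).
      apply Rabs_le_between. lra.
    + apply Rmult_le_compat; try lra; unfold C; lra.
  - apply Rle_trans with (3 / rho * v).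
    + replace (3 / rho * v) with (3 * (v / rho)) by (field; lra).
      replace (r' - b) with ((r' - s) + (s - b)) by ring.
      eapply Rle_trans; [apply Rabs_triang|]. lra.
    + apply Rmult_le_compat_r; [lra|]. unfold C; lra.
  - exists k. rewrite Ec.
    set (q := omega S b / p S b) in *.
    assert (Hq : Rabs q <= N / m).
    { unfold q, Rdiv. rewrite Rabs_mult, Rabs_inv, (Rabs_pos_eq (p S b)) by lra.
      apply Rmult_le_compat; [apply Rabs_pos| | |apply Rinv_le_contravar; lra].
      - left; apply Rinv_0_lt_compat; lra.
      - apply (of_radius_bound d N); [lra|apply UB|lra]. }
    assert (E : ln (v / h) = ln v - ln h).
    { unfold Rdiv. rewrite ln_mult, ln_Rinv by (try apply Rinv_0_lt_compat; lra). ring. }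
    rewrite E.
    replace (phi' - (psi0 - q * ln a - q * (ln v - ln h)) - IZR k)
      with ((phi' - (psi + IZR k) - q * (ln h - ln xi)) + (psi - psi0)
            + q * (ln v + ln a - ln xi)) by ring.
    assert (M1 : Rabs (phi' - (psi + IZR k) - q * (ln h - ln xi))
                   <= K * 10 / rho * (v * - ln v)).
    { eapply Rle_trans; [exact L3|].
      assert (HE : Rabs (s - b) + 2 * xi <= 5 * (v / rho)) by lra.
      assert (HE0 : 0 <= Rabs (s - b) + 2 * xi) by (generalize (Rabs_pos (s - b)); lra).
      replace ((1 + N / m) * (N * (Rabs (s - b) + 2 * xi)) * (2 / m) * (ln h - ln xi))
        with (K * ((Rabs (s - b) + 2 * xi) * (ln h - ln xi))) by (unfold K; ring).
      replace (K * 10 / rho * (v * - ln v))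
        with (K * (5 * (v / rho) * (2 * - ln v))) by (field; lra).
      apply Rmult_le_compat_l; [lra|].
      apply Rmult_le_compat; try lra.
      assert (ln xi < ln h) by (apply ln_increasing; lra). lra. }
    assert (M2 : Rabs (q * (ln v + ln a - ln xi))
                   <= 2 * (N / m) * (/ rho * / rho) * v).
    { rewrite Rabs_mult.
      replace (2 * (N / m) * (/ rho * / rho) * v)
        with (N / m * (2 * (/ rho * / rho) * v)) by ring.
      apply Rmult_le_compat; trivial; apply Rabs_pos. }
    eapply Rle_trans; [apply Rabs_triang|].
    eapply Rle_trans; [apply Rplus_le_compat_r, Rabs_triang|].
    rewrite Hvln' in *.
    assert (M3 : 2 * (N / m) * (/ rho * / rho) * v
                   <= 2 * (N / m) * (/ rho * / rho) * (v * - ln v))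
      by (apply Rmult_le_compat_l; lra).
    assert (M4 : v / rho <= 1 / rho * (v * - ln v)).
    { replace (v / rho) with (1 / rho * v) by (field; lra).
      apply Rmult_le_compat_l; lra. }
    assert (M5 : 0 <= 3 / rho * (v * - ln v)) by (apply Rmult_le_pos; lra).
    unfold C. lra.
Qed.
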